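(* Let $n\ge1$, $0<d<n$, $1\le p<\infty$, let $p'$ be the conjugate exponent of $p$, let $\Phi$ be a Young function satisfying the $\Delta_2$-condition, with complementary function $\overline{\Phi}$, and let $\mathcal{T}\subset\mathcal{D}$ be a tiling of $\mathbb{R}^n$. Then there are constants $C_1,C_2>0$, independent of $f$ and of $\mathcal{T}$, such that for every measurable function $f$ on $\mathbb{R}^n$ $$\|f\|_{\mathcal{M}^{p'}_{\overline{\Phi}}(H^d)'}\le C_1\,\|f\|_{\mathcal{B}^p_{\Phi}(H^d,\mathcal{T})} \quad\text{and}\quad \|f\|_{\mathcal{B}^p_{\Phi}(H^d,\mathcal{T})}\le C_2\,\|f\|_{\mathcal{M}^{p'}_{\overline{\Phi}}(H^d,\mathcal{T})'}.$$
   Context: Dyadic cubes: $\mathcal{D}$ is the class of cubes $Q=2^{-k}(j+[0,1)^n)$, $k\in\mathbb{Z}$, $j\in\mathbb{Z}^n$; $\ell(Q)$ denotes side length. The dyadic Hausdorff content of $E\subset\mathbb{R}^n$ is $H^d(E)=\inf\{\sum_j\ell(Q_j)^d: E\subset\bigcup_jQ_j,\ Q_j\in\mathcal{D}\}$, the infimum over countable coverings. The Choquet integral of $f\ge0$ is $\int_{\mathbb{R}^n}f\,dH^d=\int_0^\infty H^d(\{f>t\})\,dt$. Write $\|f\|_{\mathcal{L}^q(H^d)}=(\int_{\mathbb{R}^n}|f|^q\,dH^d)^{1/q}$ for $0<q<\infty$ and $\|f\|_{\mathcal{L}^\infty(H^d)}=\inf\{t>0:H^d(\{|f|>t\})=0\}$.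 Conjugate exponent: $p'=p/(p-1)$ for $1<p<\infty$, $p'=\infty$ for $p=1$. A Young function is a function $\Phi:[0,\infty)\to[0,\infty]$ that is left-continuous, convex and increasing with $\Phi(0)=0$ and $\Phi(t)\to\infty$ as $t\to\infty$. $\Phi$ satisfies the $\Delta_2$-condition if for some $K>1$, $\Phi(2t)\le K\Phi(t)$ for all $t>0$. The complementary function is $\overline{\Phi}(t)=\sup\{ts-\Phi(s):s\in[0,\infty)\}$, again a Young function (''increasing'' is in the non-strict sense). For a Young function $\Psi$ and a cube $Q$, $\|f\|_{\Psi;Q}=\inf\{\lambda>0:\frac1{|Q|}\int_Q\Psi(|f(x)|/\lambda)\,dx\le1\}$. The dyadic fractional Orlicz maximal operator is $M_{\alpha,\Psi}f(x)=\sup_{Q\in\mathcal{D}}\ell(Q)^\alpha\|f\|_{\Psi;Q}\mathbf{1}_Q(x)$, $0<\alpha<n$. For $1<q\le\infty$, the Orlicz-Morrey space $\mathcal{M}^q_\Psi(H^d)$ is the set of measurable $f$ with $\|f\|_{\mathcal{M}^q_\Psi(H^d)}=\|M_{n-d,\Psi}f\|_{\mathcal{L}^q(H^d)}<\infty$. A family $\mathcal{T}\subset\mathcal{D}$ is a tiling of $\mathbb{R}^n$ if $\sum_{Q\in\mathcal{T}}\mathbf{1}_Q(x)=1$ for all $x\in\mathbb{R}^n$. The Orlicz block space $\mathcal{B}^p_\Phi(H^d,\mathcal{T})$ and the Orlicz-Morrey space $\mathcal{M}^{p'}_{\overline{\Phi}}(H^d,\mathcal{T})$ are the sets of measurable functions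 for which, respectively, $$\|f\|_{\mathcal{B}^p_\Phi(H^d,\mathcal{T})}=\left\|\sum_{Q\in\mathcal{T}}\|f\|_{\Phi;Q}^p\mathbf{1}_Q\right\|_{\mathcal{L}^1(H^d)}^{1/p}<\infty,\qquad \|g\|_{\mathcal{M}^{p'}_{\overline{\Phi}}(H^d,\mathcal{T})}=\left\|\sum_{Q\in\mathcal{T}}\left(\ell(Q)^{n-d}\|g\|_{\overline{\Phi};Q}\right)^{p'}\mathbf{1}_Q\right\|_{\mathcal{L}^1(H^d)}^{1/p'}<\infty,$$ where for $p=1$ ($p'=\infty$) the latter is read as $\sup_{Q\in\mathcal{T}}\ell(Q)^{n-d}\|g\|_{\overline{\Phi};Q}$. For such a space $X$ of measurable functions, the associate norm is $\|f\|_{X'}=\sup\{\int_{\mathbb{R}^n}|f(x)g(x)|\,dx:\ \|g\|_X\le1\}$. All norms are allowed to take the value $+\infty$. *)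

(* Defs.v *)
From HB Require Import structures.
From mathcomp Require Import all_boot all_order all_algebra.
From mathcomp Require Import all_classical all_reals all_analysis.
From mathcomp Require Import ring.

Set Implicit Arguments.
Unset Strict Implicit.
Unset Printing Implicit Defensive.
Import Order.TTheory GRing.Theory Num.Theory.
Import numFieldNormedType.Exports.

Local Open Scope classical_set_scope.
Local Open Scope ring_scope.
Local Open Scope ereal_scope.

(* Lebesgue measure on R^n: the n-fold product of the Borel Lebesgue measure,
   built one coordinate at a time, and then its completion. *)
Section borel_step.
Context {R : realType} (n : nat).
Variable mu : {sigma_finite_measure set (n.-tuple R) -> \bar R}.

Definition tcons (z : measurableTypeR R * n.-tuple R) : n.+1.-tuple R :=
  [the n.+1.-tuple R of (z.1 : R) :: z.2].

Lemma measurable_tcons : measurable_fun setT tcons.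
Proof. exact: measurable_cons. Qed.

Lemma measurable_tcons_preimage (A : set (n.+1.-tuple R)) :
  measurable A -> measurable (tcons @^-1` A).
Proof. by move=> mA; rewrite -[X in measurable X]setTI; exact: measurable_tcons. Qed.

Definition borel_step : set (n.+1.-tuple R) -> \bar R :=
  pushforward (lebesgue_measure \x mu) tcons.

Let borel_step0 : borel_step set0 = 0.
Proof. by rewrite /borel_step /pushforward preimage_set0 measure0. Qed.

Let borel_step_ge0 A : 0 <= borel_step A.
Proof. exact: (measure_ge0 (lebesgue_measure \x mu)). Qed.

Let borel_step_sigma_additive : semi_sigma_additive borel_step.
Proof.
move=> F mF tF mUF; rewrite /borel_step /pushforward preimage_bigcup.
apply: measure_semi_sigma_additive.
- by move=> k; exact: measurable_tcons_preimage.
- apply/trivIsetP => /= i j _ _ ij; rewrite -preimage_setI.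
  by move/trivIsetP : tF => /(_ _ _ _ _ ij) ->//; rewrite preimage_set0.
- by rewrite -preimage_bigcup; exact: measurable_tcons_preimage.
Qed.

HB.instance Definition _ := isMeasure.Build _ _ _ borel_step
  borel_step0 borel_step_ge0 borel_step_sigma_additive.

Lemma borel_stepE (A : set R) (B : set (n.-tuple R)) :
  measurable A -> measurable B ->
  borel_step [set x : n.+1.-tuple R | A (thead x) /\ B [tuple of behead x]] =
  lebesgue_measure A * mu B.
Proof.
move=> mA mB; rewrite /borel_step /pushforward -product_measure1E//.
congr (_ _); apply/seteqP; split=> -[a t] /=; rewrite theadE.
  by move=> [? ht]; split=> //; congr B : ht; exact/val_inj.
by move=> [? ht]; split=> //; congr B : ht; exact/val_inj.
Qed.

Let borel_step_sigma_finite : sigma_finite setT borel_step.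
Proof.
have /sigma_finiteP[F [TF ndF Foo]] := sigma_finiteT (@lebesgue_measure R).
have /sigma_finiteP[G [TG ndG Goo]] := sigma_finiteT mu.
exists (fun k => [set x : n.+1.-tuple R | F k (thead x) /\ G k [tuple of behead x]]).
  rewrite predeqE => x; split=> // _.
  have [i _ Fi] : (\bigcup_i F i) (thead x) by rewrite -TF.
  have [j _ Gj] : (\bigcup_i G i) [tuple of behead x] by rewrite -TG.
  exists (maxn i j) => //; split.
    by move: Fi; exact/subsetPset/ndF/leq_maxl.
  by move: Gj; exact/subsetPset/ndG/leq_maxr.
move=> k; have [mF ?] := Foo k; have [mG ?] := Goo k; split.
  apply: measurableI.
    rewrite -[X in measurable X]setTI.
    by apply: (@measurable_tnth _ R n.+1 ord0) => //.
  by rewrite -[X in measurable X]setTI; exact: measurable_behead.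
by rewrite borel_stepE// lte_mul_pinfty// ge0_fin_numE.
Qed.

HB.instance Definition _ := Measure_isSigmaFinite.Build _ _ _ borel_step
  borel_step_sigma_finite.

End borel_step.

Fixpoint borel_lebesgue (R : realType) (n : nat) :
    {sigma_finite_measure set (n.-tuple R) -> \bar R} :=
  match n with
  | 0%N => @dirac _ (0.-tuple R) [tuple] R
  | m.+1 => borel_step (borel_lebesgue R m)
  end.

Definition box {R : realType} n (s : R) (j : n.-tuple int) : set (n.-tuple R) :=
  [set x | forall i, (s * (tnth j i)%:~R <= tnth x i < s * ((tnth j i)%:~R + 1))%R].

Lemma measurable_box {R : realType} n s (j : n.-tuple int) :
  measurable (box s j : set (n.-tuple R)).
Proof.
rewrite (_ : box s j = \big[setI/setT]_(i < n)
  ((fun x : n.-tuple R => tnth x i) @^-1`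
     `[(s * (tnth j i)%:~R)%R, (s * ((tnth j i)%:~R + 1))%R[%classic)); last first.
  apply/seteqP; split=> x /=.
    move=> h; elim/big_ind : _ => //= i _; by rewrite in_itv/=; exact: h.
  rewrite -bigcap_seq => h i; have := h i.
  by rewrite /= in_itv /=; apply; rewrite mem_index_enum.
apply: bigsetI_measurable => i _; rewrite -[X in measurable X]setTI.
exact: measurable_tnth.
Qed.

Lemma borel_lebesgue_box {R : realType} n (s : R) (j : n.-tuple int) : (0 < s)%R ->
  borel_lebesgue R n (box s j) = (s ^+ n)%:E.
Proof.
move=> s0; elim: n j => [j|n ih j] /=.
  by rewrite diracE mem_set// => -[].
have -> : box s j = [set x : n.+1.-tuple R |
   `[(s * (thead j)%:~R)%R, (s * ((thead j)%:~R + 1))%R[%classic (thead x) /\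
   box s [tuple of behead j] [tuple of behead x]].
  have lE (k : 'I_n) : inord k.+1 = lift ord0 k :> 'I_n.+1.
    by apply/val_inj; rewrite /= inordK ?ltnS.
  apply/seteqP; split=> x /=; rewrite in_itv /=.
    move=> h; split=> [|i]; first exact: (h ord0).
    by have := h (lift ord0 i); rewrite !tnth_behead lE.
  move=> [h0 h] i; case: (unliftP ord0 i) => [k ->|->]; last exact: h0.
  by have := h k; rewrite !tnth_behead lE.
rewrite borel_stepE//; last exact: measurable_box.
rewrite ih lebesgue_measure_itv/= lte_fin ltr_pM2l// ltrDl ltr01 -EFinD -EFinM.
by congr EFin; rewrite exprS; ring.
Qed.

(* R^n with the sigma-algebra of Lebesgue measurable sets *)
Definition Rn (R : realType) (n : nat) :=
  caratheodory_type (borel_lebesgue R n)^*%mu.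

HB.instance Definition _ (R : realType) (n : nat) := Measurable.on (Rn R n).

Definition leb (R : realType) (n : nat) :
    {measure set (Rn R n) -> \bar R} :=
  @completed_measure_extension _ _ _ (borel_lebesgue R n).

(* (k, j) encodes the cube 2^-k (j + [0, 1)^n); for n >= 1 distinct codes give
   distinct cubes. *)
Definition dyadic (n : nat) := (int * n.-tuple int)%type.

Section dyadic_spaces.
Context {R : realType} {n : nat}.
Local Notation X := (Rn R n).
Implicit Types (Q : dyadic n) (T : set (dyadic n)) (E : set X) (Psi : R -> \bar R).

Definition side Q : R := ((2 : R) ^ (- Q.1))%R.

Definition cube Q : set X :=
  [set x | forall i : 'I_n,
    (side Q * (tnth Q.2 i)%:~R <= tnth (x : n.-tuple R) i
       < side Q * ((tnth Q.2 i)%:~R + 1))%R].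

(* The Luxemburg average ||f||_{Psi; Q}; the infimum of the empty set is +oo. *)
Definition orlicz_avg Psi Q (f : X -> R) : \bar R :=
  ereal_inf [set l%:E | l in [set l : R | (0 < l)%R /\
    (fine (leb R n (cube Q)))^-1%:E *
      \int[leb R n]_(x in cube Q) Psi (`|f x| / l)%R <= 1]].

Definition hcontent (d : R) E : \bar R :=
  ereal_inf [set \esum_(Q in A) (side Q `^ d)%:E | A in
    [set A : set (dyadic n) | countable A /\ E `<=` \bigcup_(Q in A) cube Q]].

Definition choquet (d : R) (f : X -> \bar R) : \bar R :=
  \int[lebesgue_measure]_(t in `[0%R, +oo[) hcontent d [set x | t%:E < f x].

(* Only the exponents 0 < q <= +oo are meaningful, here and in the Morrey
   norms below; the value at -oo is a dummy. *)
Definition choquet_norm (d : R) (q : \bar R) (f : X -> \bar R) : \bar R :=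
  match q with
  | r%:E => choquet d (fun x => `|f x| `^ r) `^ r^-1
  | +oo => ereal_inf [set t%:E | t in [set t : R |
             (0 < t)%R /\ hcontent d [set x | t%:E < `|f x|] = 0]]
  | -oo => 0
  end.

Definition frac_max (alpha : R) Psi (f : X -> R) (x : X) : \bar R :=
  ereal_sup [set (side Q `^ alpha)%:E * orlicz_avg Psi Q f * (\1_(cube Q) x)%:E
            | Q in [set: dyadic n]].

Definition morrey_norm (d : R) (q : \bar R) Psi (f : X -> R) : \bar R :=
  choquet_norm d q (frac_max (n%:R - d) Psi f).

Definition tiling T := forall x : X, \esum_(Q in T) (\1_(cube Q) x)%:E = 1 :> \bar R.

Definition block_norm (d p : R) Psi T (f : X -> R) : \bar R :=
  choquet_norm d 1 (fun x =>
    \esum_(Q in T) (orlicz_avg Psi Q f `^ p * (\1_(cube Q) x)%:E)) `^ p^-1.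

Definition morrey_tiling_norm (d : R) (q : \bar R) Psi T (g : X -> R) : \bar R :=
  match q with
  | r%:E => choquet_norm d 1 (fun x =>
      \esum_(Q in T) (((side Q `^ (n%:R - d))%:E * orlicz_avg Psi Q g) `^ r
                      * (\1_(cube Q) x)%:E)) `^ r^-1
  | +oo => ereal_sup [set (side Q `^ (n%:R - d))%:E * orlicz_avg Psi Q g | Q in T]
  | -oo => 0
  end.

Definition associate_norm (N : (X -> R) -> \bar R) (f : X -> R) : \bar R :=
  ereal_sup [set \int[leb R n]_x `|f x * g x|%:E
            | g in [set g : X -> R | measurable_fun setT g /\ N g <= 1]].

End dyadic_spaces.

Lemma side_gt0 {R : realType} {n} (Q : dyadic n) : (0 < side Q :> R)%R.
Proof. exact: exprz_gt0. Qed.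

Lemma leb_cube {R : realType} n (Q : dyadic n) :
  leb R n (cube Q) = (side Q ^+ n)%:E.
Proof.
rewrite -(@borel_lebesgue_box R n _ Q.2); last exact: side_gt0.
rewrite -(measurable_mu_extE (borel_lebesgue R n)) //.
exact: measurable_box.
Qed.

Section young.
Context {R : realType}.
Implicit Types Phi : R -> \bar R.

(* A Young function is given by its values on [0, +oo); its values at negative
   arguments are irrelevant. *)
Record young Phi : Prop := Young {
  young0 : Phi 0%R = 0;
  young_ge0 : forall t, (0 <= t)%R -> 0 <= Phi t;
  young_nd : forall s t, (0 <= s)%R -> (s <= t)%R -> Phi s <= Phi t;
  young_convex : forall s t a, (0 <= s)%R -> (0 <= t)%R -> (0 <= a <= 1)%R ->
    Phi (a * s + (1 - a) * t)%R <= a%:E * Phi s + (1 - a)%:E * Phi t;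
  young_left : forall t, (0 < t)%R -> Phi x @[x --> t^'-] --> Phi t;
  young_infty : Phi t @[t --> +oo%R] --> +oo
}.

Definition delta2 Phi :=
  exists2 K : R, (1 < K)%R & forall t, (0 < t)%R -> Phi (2 * t)%R <= K%:E * Phi t.

Definition complementary Phi (t : R) : \bar R :=
  ereal_sup [set (t * s)%:E - Phi s | s in [set s : R | (0 <= s)%R]].

End young.

(* Main.v *)
Require Import Defs.
From mathcomp Require Import all_boot all_order all_algebra.
From mathcomp Require Import all_classical all_reals all_analysis.
From mathcomp Require Import measurable_realfun ring.
Set Implicit Arguments.
Unset Strict Implicit.
Unset Printing Implicit Defensive.
Import Order.TTheory GRing.Theory Num.Theory.
Import numFieldNormedType.Exports.
Local Open Scope classical_set_scope.
Local Open Scope ring_scope.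
Local Open Scope ereal_scope.

(** The theorem rests on two comparisons between the dyadic content and sums over the cubes of
    the tiling.  Write [a Q] for the Luxemburg average of [f] over [Q], [v Q] for the Morrey
    quantity [side Q ^ (n - d) * avg Q g] of [g], and [b Q] for the supremum of [v] over all dyadic
    cubes containing [Q]; the maximal function is at least [b Q] on [Q].

    First inequality.  Hoelder's inequality on each cube gives
    [int |f g| <= 2 * sum_Q side Q ^ d * a Q * v Q = 2 * sum_Q m Q * a Q * b Q] with
    [m Q = side Q ^ d * v Q / b Q].  The sum of [side Q ^ d] over disjoint cubes is in general much
    larger than the content of their union; the weights [m] are smaller, and satisfy a
    Carleson packing condition: the sum of [m Q] over the cubes [Q] of the tiling inside a cube [P]
    is at most [2 * side P ^ d] ([morrey_weight_packing]), because volume times Luxemburg average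
    is subadditive up to a factor 2 ([orlicz_avg_packing]) and [b Q >= v P].  Nestedness of dyadic
    cubes upgrades this to [sum_(Q in S) m Q <= 3 * H (union of S)] for all subfamilies [S]
    ([packing_hcontent]), and the layer cake formula upgrades it further to
    [sum_Q m Q * c Q <= 3 * int F dH] whenever [c Q <= F] on [Q] ([packing_choquet]).  Hoelder's
    inequality for the weights [m] then separates [a] from [b], and each factor is
    bounded by a Choquet integral: that of the block norm of [f], and that of the maximal function
    of [g].

    Second inequality.  The content of a union of cubes is at most the sum of [side Q ^ d], so the
    block norm of [f], and the tiling norm of any [g], are at most the power sums of their averages
    with weights [side Q ^ d] ([choquet_le_esum]).  It therefore suffices to test with one [g] that is
    extremal for the weighted sums: on each cube it is a multiple of a function norming [a Q]
    ([orlicz_dual]), the multiples being those of equality in Hoelder's inequality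
    ([associate_tiling_ge]). *)

(** * Countable sums, disjoint families and the layer cake formula *)

Section countable_sums.
Context {R : realType} {I : countType}.
Implicit Types (A B : set I) (a : I -> \bar R).

(** Sums over a countable type are turned into series, for which the exchange with an
    integral is known; [pickle_inv] vanishes off the image of [pickle], so that no term
    is counted twice. *)
Definition pickle_seq A a (k : nat) : \bar R :=
  if pickle_inv k is Some i then if i \in A then a i else 0 else 0.

Lemma pickle_seq_ge0 A a k : (forall i, A i -> 0 <= a i) ->
  0 <= pickle_seq A a k.
Proof.
by move=> a0; rewrite /pickle_seq; case: pickle_inv => // i; case: ifPn => // /set_mem/a0.
Qed.

Lemma esum_pickle A a : (forall i, A i -> 0 <= a i) ->
  \esum_(i in A) a i = \sum_(k <oo) pickle_seq A a k.
Proof.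
move=> a0; rewrite nneseries_esumT; last by move=> k; exact: pickle_seq_ge0.
have pinj : set_inj A (@pickle I) by move=> x y _ _ /(pcan_inj (@pickleK I)).
transitivity (\esum_(k in @pickle I @` A) pickle_seq A a k).
  rewrite esum_image//; apply: eq_esum => i Ai.
  by rewrite /pickle_seq pickleK_inv mem_set.
rewrite esum_mkcond; apply: eq_esum => k _; case: ifPn => // /negP kA.
rewrite /pickle_seq; have := @pickle_invK I k.
case: pickle_inv => //= i ik; case: ifPn => // /set_mem Ai.
by case: kA; apply: mem_set; exists i.
Qed.

Lemma esumZl A a (c : R) : (forall i, A i -> 0 <= a i) -> (0 <= c)%R ->
  \esum_(i in A) (c%:E * a i) = c%:E * \esum_(i in A) a i.
Proof.
move=> a0 c0; rewrite !esum_pickle//; last first.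
  by move=> i Ai; rewrite mule_ge0 ?lee_fin// a0.
rewrite -nneseriesZl; last by move=> k _; exact: pickle_seq_ge0.
apply: eq_eseriesr => k _; rewrite /pickle_seq; case: pickle_inv => [i|]; rewrite ?mule0//.
by case: ifPn; rewrite ?mule0.
Qed.

Lemma integral_esum d (X : measurableType d) (mu : {measure set X -> \bar R})
    (D : set X) A (f : I -> X -> \bar R) : measurable D ->
  (forall i, A i -> measurable_fun D (f i)) ->
  (forall i x, A i -> D x -> 0 <= f i x) ->
  \int[mu]_(x in D) (\esum_(i in A) f i x) =
  \esum_(i in A) \int[mu]_(x in D) f i x.
Proof.
move=> mD mf f0.
rewrite esum_pickle; last by move=> i Ai; apply: integral_ge0 => x Dx; exact: f0.
transitivity (\int[mu]_(x in D) (\sum_(k <oo) pickle_seq A (f ^~ x) k)).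
  by apply: eq_integral => x /set_mem Dx; rewrite esum_pickle// => i Ai; exact: f0.
rewrite integral_nneseries//; last 2 first.
- move=> k; rewrite /pickle_seq; case: pickle_inv => [i|]; last exact: measurable_cst.
  by case: (i \in A) (@set_mem _ A i) => [/(_ isT)/mf|_]//; exact: measurable_cst.
- by move=> k x Dx; apply: pickle_seq_ge0 => i Ai; exact: f0.
apply: eq_eseriesr => k _; rewrite /pickle_seq; case: pickle_inv => [i|]; last by rewrite integral0.
by case: ifPn => // _; rewrite integral0.
Qed.

Lemma measurable_esum d (X : measurableType d)
    (D : set X) A (f : I -> X -> \bar R) : measurable D ->
  (forall i, A i -> measurable_fun D (f i)) ->
  (forall i x, A i -> D x -> 0 <= f i x) ->
  measurable_fun D (fun x => \esum_(i in A) f i x).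
Proof.
move=> mD mf f0.
apply: (eq_measurable_fun (fun x => \sum_(k <oo) pickle_seq A (f ^~ x) k)).
  by move=> x /set_mem Dx; rewrite esum_pickle// => i Ai; exact: f0.
apply: ge0_emeasurable_sum.
  by move=> k x Dx _; apply: pickle_seq_ge0 => i Ai; exact: f0.
move=> k _; rewrite /pickle_seq; case: pickle_inv => [i|]; last exact: measurable_cst.
by case: (i \in A) (@set_mem _ A i) => [/(_ isT)/mf|_]//; exact: measurable_cst.
Qed.

Lemma le_esum_subset A B a : A `<=` B -> (forall i, B i -> 0 <= a i) ->
  \esum_(i in A) a i <= \esum_(i in B) a i.
Proof.
move=> AB a0; rewrite [leLHS]esum_mkcond [leRHS]esum_mkcond; apply: le_esum => i _.
case: ifPn => [/set_mem/AB Bi|_]; first by rewrite mem_set.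
by case: ifPn => // /set_mem/a0.
Qed.

Lemma esum_ge_term A a i : A i -> (forall j, A j -> 0 <= a j) ->
  a i <= \esum_(j in A) a j.
Proof.
move=> Ai a0; rewrite -(@esum_set1 _ _ i a (a0 _ Ai)).
by apply: le_esum_subset => // j ->.
Qed.

End countable_sums.

Lemma exchange_esum {R : realType} {I J : countType} (A : set I) (B : set J)
    (a : I -> J -> \bar R) :
  (forall i j, A i -> B j -> 0 <= a i j) ->
  \esum_(i in A) \esum_(j in B) a i j = \esum_(j in B) \esum_(i in A) a i j.
Proof.
move=> a0; rewrite esum_esum// esum_esum; last by move=> *; exact: a0.
rewrite (@reindex_esum _ _ _ (B `*`` fun=> A) (A `*`` fun=> B) (fun k => (k.2, k.1)))//.
split=> //=.
- by move=> [i j] [].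
- by move=> [i j] [k l] _ _ /= [-> ->].
- by move=> [i j] [Ai Bj]; exists (j, i).
Qed.

Section disjoint_families.
Context {R : realType} {I : countType}.
Implicit Types (A : set I) (a : I -> \bar R).

Lemma esum_indic_disjoint {Y : Type} A (F : I -> set Y) a i x :
  trivIset A F -> A i -> F i x -> (forall j, A j -> 0 <= a j) ->
  \esum_(j in A) (a j * (\1_(F j) x)%:E) = a i.
Proof.
move=> tF Ai Fx a0.
have ge0 j : A j -> 0 <= a j * (\1_(F j) x)%:E.
  by move=> Aj; rewrite mule_ge0 ?a0// lee_fin.
rewrite (esumID [set i])// [X in _ + X]esum1 ?adde0; last first.
  move=> j [Aj /= ji]; rewrite indicE memNset ?mule0// => Fj.
  by apply: ji; apply: (tF j i) => //; exists x.
have -> : A `&` [set i] = [set i] by apply/seteqP; split => [j []//|j ->].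
by rewrite esum_set1 ?ge0// indicE mem_set// mule1.
Qed.

Lemma esum_indic_notin {Y : Type} A (F : I -> set Y) a x :
  (forall j, A j -> ~ F j x) -> \esum_(j in A) (a j * (\1_(F j) x)%:E) = 0.
Proof. by move=> nF; apply: esum1 => j Aj; rewrite indicE memNset ?mule0//; exact: nF. Qed.

Lemma measure_le_esum d (Y : measurableType d) (mu : {measure set Y -> \bar R})
    (F : I -> set Y) A (E : set Y) : (forall i, measurable (F i)) -> measurable E ->
  E `<=` \bigcup_(i in A) F i -> mu E <= \esum_(i in A) mu (F i).
Proof.
move=> mF mE EF.
have intE B : measurable B -> mu B = \int[mu]_x (\1_B x : R)%:E.
  by move=> mB; rewrite integral_indic ?setIT.
have mI B : measurable B -> measurable_fun setT (fun x : Y => (\1_B x : R)%:E).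
  by move=> mB; apply/measurable_EFinP; exact: measurable_indic.
rewrite intE// (eq_esum (fun i _ => intE _ (mF i))) -integral_esum//; last first.
  by move=> i _; exact: mI.
apply: ge0_le_integral => //.
- exact: mI.
- by apply: measurable_esum => // i _; exact: mI.
- move=> x _; rewrite [X in X%:E <= _]indicE; have [/set_mem Ex|_] := boolP (x \in E); last first.
    by apply: esum_ge0 => i _; rewrite lee_fin.
  have [i Ai Fx] := EF x Ex.
  apply: le_trans (esum_ge_term Ai _); first by rewrite indicE mem_set.
  by move=> *; rewrite lee_fin.
Qed.

(** Gluing functions along a disjoint family.  Going through a sum of extended reals makes
    measurability immediate; on a disjoint family at most one term is nonzero, so [fine]
    does not lose anything. *)
Definition piecewise {Y : Type} A (F : I -> set Y) (u : I -> Y -> R) (x : Y) : R :=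
  fine (\esum_(i in A) ((u i x)%:E * (\1_(F i) x)%:E)).

Lemma piecewise_in {Y : Type} A (F : I -> set Y) (u : I -> Y -> R) i x :
  trivIset A F -> (forall j y, A j -> (0 <= u j y)%R) -> A i -> F i x ->
  piecewise A F u x = u i x.
Proof.
move=> tF u0 Ai Fx.
rewrite /piecewise (esum_indic_disjoint (a := fun i => (u i x)%:E) tF Ai Fx)// => j Aj.
by rewrite lee_fin u0.
Qed.

Lemma piecewise_notin {Y : Type} A (F : I -> set Y) (u : I -> Y -> R) x :
  (forall j, A j -> ~ F j x) -> piecewise A F u x = 0%R.
Proof. by move=> nF; rewrite /piecewise (esum_indic_notin (fun i => (u i x)%:E)). Qed.

Lemma measurable_piecewise d (Y : measurableType d) A (F : I -> set Y) (u : I -> Y -> R) :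
  (forall i, measurable (F i)) -> (forall i, A i -> measurable_fun setT (u i)) ->
  (forall j y, A j -> (0 <= u j y)%R) -> measurable_fun setT (piecewise A F u).
Proof.
move=> mF mu0 u0; apply: (measurableT_comp (fine_measurable measurableT)).
apply: measurable_esum => //.
- move=> i Ai; apply: emeasurable_funM; apply/measurable_EFinP; first exact: mu0.
  exact: measurable_indic.
- by move=> i x Ai _; rewrite mule_ge0// lee_fin ?u0.
Qed.

Context d (Y : measurableType d) (mu : {measure set Y -> \bar R}).
Variables (F : I -> set Y) (A : set I).
Hypothesis mF : forall i, measurable (F i).
Hypothesis tF : trivIset A F.

Lemma esum_integral_indic (D : set Y) (h : Y -> \bar R) : measurable D ->
  (forall i, A i -> F i `<=` D) -> measurable_fun D h -> (forall x, D x -> 0 <= h x) ->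
  \esum_(i in A) \int[mu]_(x in F i) h x =
  \int[mu]_(x in D) (\esum_(i in A) (h x * (\1_(F i) x)%:E)).
Proof.
move=> mD FD mh h0; rewrite integral_esum//.
- apply: eq_esum => i Ai.
  rewrite -[in LHS](setIidr (FD _ Ai)) integral_mkcondr.
  by apply: eq_integral => x _; rewrite epatch_indic.
- move=> i Ai; apply: emeasurable_funM => //; apply: measurable_funTS.
  by apply/measurable_EFinP; exact: measurable_indic.
- by move=> i x Ai Dx; rewrite mule_ge0 ?h0// lee_fin.
Qed.

Lemma esum_integral_le (D : set Y) (h : Y -> \bar R) : measurable D ->
  (forall i, A i -> F i `<=` D) -> measurable_fun D h -> (forall x, D x -> 0 <= h x) ->
  \esum_(i in A) \int[mu]_(x in F i) h x <= \int[mu]_(x in D) h x.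
Proof.
move=> mD FD mh h0; rewrite (esum_integral_indic mD)//.
have ge0 i x : D x -> 0 <= h x * (\1_(F i) x)%:E by move=> Dx; rewrite mule_ge0 ?h0// lee_fin.
apply: ge0_le_integral => //.
- by move=> x Dx; apply: esum_ge0 => i _; exact: ge0.
- apply: measurable_esum => //; last by move=> i x _; exact: ge0.
  move=> i _; apply: emeasurable_funM => //; apply: measurable_funTS.
  by apply/measurable_EFinP; exact: measurable_indic.
- move=> x Dx; have [[i [Ai Fx]]|nF] := pselect (exists i, A i /\ F i x); last first.
    by rewrite (esum_indic_notin (fun=> h x)) ?h0// => i Ai Fx; apply: nF; exists i.
  by rewrite (esum_indic_disjoint (a := fun=> h x) tF Ai Fx)// => *; exact: h0.
Qed.

Lemma integral_partition (h : Y -> \bar R) : (forall x, exists2 i, A i & F i x) ->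
  measurable_fun setT h -> (forall x, 0 <= h x) ->
  \int[mu]_x h x = \esum_(i in A) \int[mu]_(x in F i) h x.
Proof.
move=> cF mh h0; rewrite (@esum_integral_indic setT)//.
apply: eq_integral => x _; have [i Ai Fx] := cF x.
by rewrite (esum_indic_disjoint (a := fun=> h x) tF Ai Fx).
Qed.

End disjoint_families.

Lemma nonincreasing_emeasurable {R : realType} (D : set R) (f : R -> \bar R) :
  measurable D -> (forall s t, (s <= t)%R -> f t <= f s) -> measurable_fun D f.
Proof.
move=> mD nif; apply: (measurability _ (ErealGenOInfty.measurableE R)).
move=> /= _ [_ [a ->]] <-; apply: measurableI => //; apply: is_interval_measurable.
move=> s t /=; rewrite !in_itv/= !andbT => _ aft u /andP[_ ut].
by rewrite in_itv/= andbT (lt_le_trans aft)// nif.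
Qed.

Lemma nondecreasing_emeasurable {R : realType} (D : set R) (f : R -> \bar R) :
  measurable D -> (forall s t, (s <= t)%R -> f s <= f t) -> measurable_fun D f.
Proof.
move=> mD ndf; apply: (measurability _ (ErealGenOInfty.measurableE R)).
move=> /= _ [_ [a ->]] <-; apply: measurableI => //; apply: is_interval_measurable.
move=> s t /=; rewrite !in_itv/= !andbT => afs _ u /andP[su _].
by rewrite in_itv/= andbT (lt_le_trans afs)// ndf.
Qed.

Lemma integral_lt_ereal {R : realType} (c : \bar R) : 0 <= c ->
  \int[lebesgue_measure]_(t in `[0%R, +oo[) (\1_[set t : R | (t%:E < c)%E] t)%:E = c.
Proof.
move=> c0; rewrite integral_indic//; last first.
  apply: is_interval_measurable => s t /= _ tc u /andP[_ ut].
  by rewrite (le_lt_trans _ tc)// lee_fin.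
case: c c0 => [c c0|_|//].
  have -> : [set t | t%:E < c%:E] `&` `[0%R, +oo[ = [set` `[0%R, c[ ] :> set R.
    apply/seteqP; split=> t /=; rewrite !in_itv/= !lte_fin ?andbT; first by move=> [-> ->].
    by move=> /andP[-> ->].
    apply: (etrans (lebesgue_measure_itv `[0%R, c[)); rewrite /= lte_fin; case: ifPn; first by rewrite sube0.
  by rewrite -leNgt => c0'; congr EFin; apply/eqP; rewrite eq_le c0' -lee_fin c0.
have -> : [set t : R | t%:E < +oo] `&` `[0%R, +oo[ = [set` `[0%R, +oo[ ] :> set R.
  by apply/seteqP; split=> t /=; rewrite ?ltry; [case|].
by apply: (etrans (lebesgue_measure_itv `[0%R, +oo[)); rewrite /= ltry.
Qed.

(** Tonelli, after writing [c i] as the length of [{t >= 0 | t < c i}].  With [m i] the weight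
    of a cube, both inequalities between a sum over cubes and a Choquet integral reduce
    through it to one comparison of level sets for each [t]. *)
Lemma layer_cake {R : realType} {I : countType} (A : set I) (m : I -> R) (c : I -> \bar R) :
  (forall i, A i -> (0 <= m i)%R) -> (forall i, A i -> 0 <= c i) ->
  \int[lebesgue_measure]_(t in `[0%R, +oo[)
     (\esum_(i in A `&` [set i | t%:E < c i]) (m i)%:E) =
  \esum_(i in A) ((m i)%:E * c i).
Proof.
move=> m0 c0.
have E (t : R) : \esum_(i in A `&` [set i | t%:E < c i]) (m i)%:E =
    \esum_(i in A) ((m i)%:E * (\1_[set t : R | (t%:E < c i)%E] t)%:E).
  rewrite esum_mkcondr; apply: eq_esum => i Ai; rewrite indicE.
  have [tc|/negP tc] := boolP (t%:E < c i); first by rewrite !mem_set ?mule1.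
  by rewrite !memNset ?mule0.
transitivity (\int[lebesgue_measure]_(t in `[0%R, +oo[)
   (\esum_(i in A) ((m i)%:E * (\1_[set t : R | (t%:E < c i)%E] t)%:E))).
  by apply: eq_integral => t _; exact: E.
have mI i : measurable_fun (`[0%R, +oo[%classic : set R)
    (fun t : R => (\1_[set t : R | (t%:E < c i)%E] t : R)%:E).
  have noninc (s t : R) : (s <= t)%R ->
      (\1_[set t : R | (t%:E < c i)%E] t)%:E <= (\1_[set t : R | (t%:E < c i)%E] s)%:E :> \bar R.
    move=> st; rewrite lee_fin !indicE.
    have [tc|/negP tc] := boolP (t%:E < c i); last first.
      by rewrite [t \in _]memNset ?ler0n.
    by rewrite !mem_set//= (le_lt_trans _ tc)// lee_fin.
  exact: (nonincreasing_emeasurable (measurable_itv _) noninc).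
rewrite integral_esum//; last 2 first.
- by move=> i Ai; apply: measurable_funeM; exact: mI.
- by move=> i t Ai _; rewrite mule_ge0// lee_fin// m0.
apply: eq_esum => i Ai.
rewrite ge0_integralZl_EFin ?m0//; last exact: mI.
by rewrite integral_lt_ereal ?c0.
Qed.

(** * Dyadic cubes and their content *)

Section cubes.
Context {R : realType} {n : nat}.
Local Notation X := (Rn R n).
Local Notation cube := (@cube R n).
Local Notation side := (@side R n).
Implicit Types (P Q : dyadic n) (S T : set (dyadic n)).

Lemma measurable_cube Q : measurable (cube Q).
Proof. by apply: sub_caratheodory; apply: sub_sigma_algebra; exact: measurable_box. Qed.

Lemma cube_corner Q : cube Q [tuple (side Q * (tnth Q.2 i)%:~R)%R | i < n].
Proof. by move=> i; rewrite tnth_mktuple lexx/= ltr_pM2l ?side_gt0// ltrDl ltr01. Qed.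

Lemma side_le_code P Q : (side P <= side Q)%R -> (Q.1 <= P.1)%R.
Proof.
rewrite /Defs.side; apply: contraTT; rewrite -!ltNge => PQ.
by rewrite ltr_eXz2l ?ltrN2// ltr1n.
Qed.

(** The endpoints of [Q] are integer multiples of the side of the smaller cube [P], hence
    no endpoint of [Q] falls strictly inside a side of [P]. *)
Lemma cube_nested P Q x : cube P x -> cube Q x -> (side P <= side Q)%R ->
  cube P `<=` cube Q.
Proof.
move=> Px Qx PQ y Py i.
have /andP[Px1 Px2] := Px i; have /andP[Qx1 Qx2] := Qx i; have /andP[Py1 Py2] := Py i.
have sP := @side_gt0 R n P.
have [m mE] : exists m : nat, P.1 = (Q.1 + m%:Z)%R.
  exists `|P.1 - Q.1|%N; rewrite gez0_abs ?subr_ge0 ?side_le_code//.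
  by rewrite subrKC.
have sQ : side Q = (side P * (2 ^+ m : int)%:~R)%R.
  rewrite /Defs.side mE opprD expfzDr// -mulrA -[LHS]mulr1; congr (_ * _)%R.
  by rewrite rmorphXn/= -exprnN mulVf ?expf_neq0.
set jP := tnth P.2 i in Px1 Px2 Py1 Py2 *; set jQ := tnth Q.2 i in Qx1 Qx2 *.
move: Qx1 Qx2; rewrite sQ -!mulrA -(intrD _ _ 1) -!intrM => Qx1 Qx2.
have le1 : (2 ^+ m * jQ <= jP)%R.
  rewrite -ltzD1 -(ltr_int R) -(ltr_pM2l sP).
  by rewrite intrD (le_lt_trans Qx1).
have le2 : (jP + 1 <= 2 ^+ m * (jQ + 1))%R.
  rewrite lezD1 -(ltr_int R) -(ltr_pM2l sP).
  by rewrite (le_lt_trans Px1).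
apply/andP; split.
  by rewrite (le_trans _ Py1)// ler_pM2l// ler_int.
by rewrite (lt_le_trans Py2)// ler_pM2l// -(intrD _ _ 1) ler_int.
Qed.

Lemma side_le_of_subset P Q : (0 < n)%N -> cube P `<=` cube Q ->
  (side P <= side Q)%R.
Proof.
move=> n0 PQ; have := le_measure (leb R n) _ _ PQ.
rewrite !inE => /(_ (measurable_cube _) (measurable_cube _)).
by rewrite [X in X <= _]leb_cube [X in _ <= X]leb_cube lee_fin ler_pXn2r// nnegrE ltW ?side_gt0.
Qed.

(** A cube of the cover that meets [Q] is contained in [Q], by nestedness, so the smaller cubes
    cover [Q] alone.  Comparing volumes and using
    [side P ^ n <= side P ^ d * side Q ^ (n - d)] for [P] inside [Q] turns the covering of
    volumes into a covering of [d]-dimensional sizes.  This is where [d <= n] enters. *)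
Lemma side_le_subcover (d : R) Q (A : set (dyadic n)) : (0 < n)%N -> (0 < d <= n%:R)%R ->
  cube Q `<=` \bigcup_(P in A) cube P ->
  (forall P, A P -> ~ cube Q `<=` cube P) ->
  (side Q `^ d)%:E <= \esum_(P in A `&` [set P | cube P `<=` cube Q]) (side P `^ d)%:E.
Proof.
move=> n0 /andP[d0 dn] QA nQ; set B := _ `&` _.
have QB x : cube Q x -> exists2 P, B P & cube P x.
  move=> Qx; have [P AP Px] := QA _ Qx; exists P => //; split => //=.
  have [|] := leP (side P) (side Q); first exact: cube_nested Px Qx.
  by move/ltW/(cube_nested Qx Px) => /(nQ _ AP).
have sQ := @side_gt0 R n Q.
have : (side Q ^+ n)%:E <= \esum_(P in B) (side P ^+ n)%:E.
  rewrite -leb_cube -(eq_esum (fun P _ => leb_cube P)).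
  apply: measure_le_esum => [P||x /QB[P BP Px]]; [exact: measurable_cube..|].
  by exists P.
have splitn (s : R) : (0 < s)%R -> (s ^+ n = s `^ d * s `^ (n%:R - d))%R.
  by move=> s0; rewrite -powRD ?subrKC ?powR_mulrn ?ltW// (gt_eqF s0) implybT.
have c0 : 0 <= (side Q `^ (d - n%:R))%:E by rewrite lee_fin powR_ge0.
move=> /(lee_wpmul2l c0).
rewrite -EFinM splitn// mulrCA -powRD ?(gt_eqF sQ) ?implybT//.
rewrite (_ : d - n%:R + (n%:R - d) = 0)%R ?powRr0 ?mulr1; last by ring.
move=> /le_trans; apply.
rewrite -esumZl ?powR_ge0//; last by move=> P _; rewrite lee_fin exprn_ge0// ltW ?side_gt0.
apply: le_esum => P [_ /= PQ]; rewrite -EFinM lee_fin splitn ?side_gt0// mulrCA.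
rewrite ler_piMr ?powR_ge0//.
rewrite (_ : d - n%:R = - (n%:R - d))%R; last by rewrite opprB.
rewrite powRN mulrC ler_pdivrMr ?powR_gt0// mul1r.
apply: ge0_ler_powR; rewrite ?subr_ge0 ?nnegrE ?(ltW (side_gt0 _))//.
exact: side_le_of_subset.
Qed.

Lemma hcontent_ge0 (d : R) (E : set X) : 0 <= hcontent d E.
Proof.
apply: le_ereal_inf_tmp => _ [A _ <-]; apply: esum_ge0 => Q _.
by rewrite lee_fin powR_ge0.
Qed.

Lemma le_hcontent (d : R) (E F : set X) : E `<=` F -> hcontent d E <= hcontent d F.
Proof.
move=> EF; apply: ereal_inf_le_tmp => _ [A [cA FA] <-]; exists A => //.
by split => //; exact: subset_trans EF FA.
Qed.

Lemma hcontent_le_cover (d : R) (E : set X) (A : set (dyadic n)) :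
  E `<=` \bigcup_(Q in A) cube Q -> hcontent d E <= \esum_(Q in A) (side Q `^ d)%:E.
Proof. by move=> EA; apply: ereal_inf_lbound; exists A => //; split => //; exact: countableP. Qed.

(** In particular a set containing a cube is never negligible for the content, which is what
    makes the suprema below finite everywhere rather than almost everywhere. *)
Lemma hcontent_cube_ge (d : R) Q (E : set X) : (0 < n)%N -> (0 < d <= n%:R)%R ->
  cube Q `<=` E -> (side Q `^ d)%:E <= hcontent d E.
Proof.
move=> n0 dn QE; apply: le_ereal_inf_tmp => _ [A [_ EA] <-].
have side0 P : A P -> 0 <= (side P `^ d)%:E by rewrite lee_fin powR_ge0.
have [[P [AP QP]]|nQ] := pselect (exists P, A P /\ cube Q `<=` cube P).
  apply: le_trans (esum_ge_term AP side0); rewrite lee_fin.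
  have /andP[d0 _] := dn.
  apply: ge0_ler_powR; rewrite ?nnegrE ?(ltW (side_gt0 _)) ?(ltW d0)//.
  exact: side_le_of_subset.
apply: le_trans (side_le_subcover n0 dn (subset_trans QE EA) _) _.
  by move=> P AP QP; apply: nQ; exists P.
by apply: le_esum_subset side0; exact: subIsetl.
Qed.

End cubes.

(** * Packing conditions and Choquet integrals *)

Section content_packing.
Context {R : realType} {n : nat}.
Local Notation X := (Rn R n).
Local Notation cube := (@cube R n).
Local Notation side := (@side R n).
Implicit Types (P Q : dyadic n) (S T : set (dyadic n)).
Variable d : R.
Hypothesis n0 : (0 < n)%N.
Hypothesis dn : (0 < d <= n%:R)%R.

Lemma tiling_trivIset T : tiling (R := R) T -> trivIset T cube.
Proof.
move=> tT P Q TP TQ [x [Px Qx]]; apply/eqP/negP => /negP PQ.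
have := tT x.
have ind0 P' : T P' -> 0 <= (\1_(cube P') x)%:E :> \bar R by rewrite lee_fin.
rewrite (esumID [set P])//.
have -> : T `&` [set P] = [set P] by apply/seteqP; split => [? []//|? ->].
rewrite esum_set1; last exact: ind0.
have : (\1_(cube Q) x)%:E <= \esum_(i in T `&` ~` [set P]) (\1_(cube i) x)%:E :> \bar R.
  apply: (@esum_ge_term _ _ _ (fun i => (\1_(cube i) x)%:E)); last by move=> i [+ _]; exact: ind0.
  by split => //= QP; move: PQ; rewrite QP eqxx.
rewrite !indicE !mem_set//= => le1 e1.
have : 1 + 1 <= (1 : \bar R) by rewrite -[leRHS]e1 leeD2l.
by rewrite -EFinD lee_fin gerDl ler10.
Qed.

Lemma tiling_cover T x : tiling (R := R) T -> exists2 Q, T Q & cube Q x.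
Proof.
move=> tT; apply: contrapT => nT; have := tT x; rewrite esum1 => [/esym/eqP|Q TQ].
  by rewrite onee_eq0.
by rewrite indicE memNset// => Qx; apply: nT; exists Q.
Qed.

(** A Carleson packing condition.  The second clause is tested on single cubes only; the point
    of [packing_hcontent] is that it then controls all unions of cubes. *)
Definition packing (K : R) (m : dyadic n -> R) T :=
  [/\ forall Q, T Q -> (0 <= m Q <= side Q `^ d)%R &
      forall P, \esum_(Q in T `&` [set Q | cube Q `<=` cube P]) (m Q)%:E
        <= (K * side P `^ d)%:E].

Lemma packing_subset K m S T : S `<=` T -> packing K m T -> packing K m S.
Proof.
move=> ST [m1 m2]; split => [Q /ST/m1//|P]; apply: le_trans (m2 P).
apply: le_esum_subset; first exact: setSI.
by move=> Q [/m1/andP[+ _] _]; rewrite lee_fin.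
Qed.

(** Take any cover [A] of the union.  The cubes of [S] lying inside a cube of [A] are handled by
    the packing condition of that cube.  Each remaining cube [Q] is covered by cubes of [A]
    strictly inside it, whose total size is at least [side Q ^ d >= m Q]; as [S] is disjoint,
    a cube of [A] is used for one such [Q] at most.  The two groups cost [K] and [1]. *)
Lemma packing_hcontent K m S : (0 <= K)%R -> trivIset S cube -> packing K m S ->
  \esum_(Q in S) (m Q)%:E <= (K + 1)%:E * hcontent d (\bigcup_(Q in S) cube Q).
Proof.
move=> K0 tS [m1 m2].
have m0 Q : S Q -> 0 <= (m Q)%:E by rewrite lee_fin => /m1/andP[].
have K1 : (0 < K + 1)%R by rewrite ltr_wpDl.
rewrite -lee_pdivrMl//; apply: le_ereal_inf_tmp => _ [A [_ SA] <-].
rewrite lee_pdivrMl// EFinD ge0_muleDl ?lee_fin// mul1e.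
have side0 P : 0 <= (side P `^ d)%:E by rewrite lee_fin powR_ge0.
pose small := [set Q | exists2 P, A P & cube Q `<=` cube P].
rewrite (esumID small)//; apply: leeD.
  have le1 : \esum_(Q in S `&` small) (m Q)%:E <=
      \esum_(Q in S) \esum_(P in A) (if Q \in [set Q | cube Q `<=` cube P] then (m Q)%:E else 0).
    rewrite esum_mkcondr; apply: le_esum => Q SQ.
    have ge0 P : A P -> 0 <= (if Q \in [set Q | cube Q `<=` cube P] then (m Q)%:E else 0).
      by move=> _; case: ifPn => // _; exact: m0.
    case: ifPn => [/set_mem[P AP QP]|_]; last exact: esum_ge0.
    by apply: le_trans (esum_ge_term AP ge0); rewrite mem_set.
  apply: (le_trans le1); rewrite exchange_esum; last first.
    by move=> Q P SQ _; case: ifPn => // _; exact: m0.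
  rewrite -esumZl//; apply: le_esum => P AP; rewrite -esum_mkcondr -EFinM.
  exact: m2.
have le1 : \esum_(Q in S `&` ~` small) (m Q)%:E <=
    \esum_(Q in S) \esum_(P in A) (if P \in [set P | cube P `<=` cube Q] then (side P `^ d)%:E else 0).
  rewrite esum_mkcondr; apply: le_esum => Q SQ.
  case: ifPn => [/set_mem /= nQ|_]; last first.
    by apply: esum_ge0 => P _; case: ifPn.
  have /m1/andP[_ mQ] := SQ.
  rewrite -esum_mkcondr; apply: (le_trans _ (side_le_subcover n0 dn _ _)); first by rewrite lee_fin.
  - by apply: subset_trans SA; exact: bigcup_sup.
  - by move=> P AP QP; apply: nQ; exists P.
apply: (le_trans le1); rewrite exchange_esum; last by move=> Q P _ _; case: ifPn.
apply: le_esum => P AP.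
have [[Q [SQ PQ]]|nP] := pselect (exists Q, S Q /\ cube P `<=` cube Q); last first.
  rewrite esum1// => Q SQ; rewrite memNset// => PQ; apply: nP.
  by exists Q.
rewrite (esumID [set Q]); last by move=> *; case: ifPn.
have -> : S `&` [set Q] = [set Q] by apply/seteqP; split => [? []//|? ->].
rewrite esum_set1 ?mem_set// esum1 ?adde0// => Q' [SQ' /= QQ'].
rewrite memNset// => /= PQ'; apply: QQ'; apply: (tS Q' Q SQ' SQ).
by exists [tuple (side P * (tnth P.2 i)%:~R)%R | i < n]; split; [apply: PQ'|apply: PQ]; exact: cube_corner.
Qed.

Lemma measurable_choquet (f : X -> \bar R) (D : set R) : measurable D ->
  measurable_fun D (fun t : R => hcontent d [set x | t%:E < f x]).
Proof.
move=> mD; apply: (nonincreasing_emeasurable mD) => s t st; apply: le_hcontent => x /=.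
by apply: le_lt_trans; rewrite lee_fin.
Qed.

Lemma choquet_ge0 (f : X -> \bar R) : 0 <= choquet d f.
Proof. by apply: integral_ge0 => t _; exact: hcontent_ge0. Qed.

(** Apply [packing_hcontent] to the cubes with [t < c Q], whose union lies in the level set of
    [f] at height [t], and integrate in [t]. *)
Lemma packing_choquet K m T (c : dyadic n -> \bar R) (f : X -> \bar R) :
  (0 <= K)%R -> trivIset T cube -> packing K m T ->
  (forall Q, T Q -> 0 <= c Q) -> (forall Q x, T Q -> cube Q x -> c Q <= f x) ->
  \esum_(Q in T) ((m Q)%:E * c Q) <= (K + 1)%:E * choquet d f.
Proof.
move=> K0 tT pT c0 cf.
have m0 Q : T Q -> (0 <= m Q)%R by case: pT => /(_ Q) + _ => /[apply] /andP[].
have K1 : (0 <= K + 1)%R by rewrite addr_ge0.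
rewrite -layer_cake//.
rewrite -ge0_integralZl_EFin//; last 2 first.
- by move=> t _; exact: hcontent_ge0.
- exact: (measurable_choquet _ (measurable_itv _)).
apply: ge0_le_integral => //.
- by move=> t _; apply: esum_ge0 => Q [/m0]; rewrite lee_fin.
- have noninc (s t : R) : (s <= t)%R ->
     \esum_(i in T `&` [set i | t%:E < c i]) (m i)%:E <=
     \esum_(i in T `&` [set i | s%:E < c i]) (m i)%:E.
    move=> st; apply: le_esum_subset; last by move=> Q [/m0]; rewrite lee_fin.
    by apply: setIS => Q /=; apply: le_lt_trans; rewrite lee_fin.
  exact: (nonincreasing_emeasurable (measurable_itv _) noninc).
- by apply: measurable_funeM; exact: (measurable_choquet _ (measurable_itv _)).
- move=> t _; apply: (le_trans (packing_hcontent K0 _ (packing_subset _ pT))).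
  + by apply: sub_trivIset tT; exact: subIsetl.
  + exact: subIsetl.
  + rewrite lee_wpmul2l ?lee_fin//; apply: le_hcontent => x [Q [TQ /= tQ] Qx] /=.
    exact: lt_le_trans tQ (cf _ _ TQ Qx).
Qed.

(** The converse comparison, for the full weights [side Q ^ d]: the level set of [f] is covered
    by the cubes with [t < c Q]. *)
Lemma choquet_le_esum T (c : dyadic n -> \bar R) (f : X -> \bar R) :
  (forall Q, T Q -> 0 <= c Q) ->
  (forall x, exists2 Q, T Q & cube Q x /\ f x <= c Q) ->
  choquet d f <= \esum_(Q in T) ((side Q `^ d)%:E * c Q).
Proof.
move=> c0 cf.
have side0 Q : T Q -> (0 <= side Q `^ d)%R by rewrite powR_ge0.
rewrite -layer_cake//; apply: ge0_le_integral => //.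
- by move=> t _; exact: hcontent_ge0.
- exact: (measurable_choquet _ (measurable_itv _)).
- have noninc (s t : R) : (s <= t)%R ->
     \esum_(i in T `&` [set i | t%:E < c i]) (side i `^ d)%:E <=
     \esum_(i in T `&` [set i | s%:E < c i]) (side i `^ d)%:E.
    move=> st; apply: le_esum_subset; last by move=> Q [/side0]; rewrite lee_fin.
    by apply: setIS => Q /=; apply: le_lt_trans; rewrite lee_fin.
  exact: (nonincreasing_emeasurable (measurable_itv _) noninc).
- move=> t _; apply: hcontent_le_cover => x /= tx.
  by have [Q TQ [Qx xQ]] := cf x; exists Q => //; split => //=; exact: lt_le_trans tx xQ.
Qed.

Lemma choquet_cube_ge Q (c : \bar R) (f : X -> \bar R) : 0 <= c ->
  (forall x, cube Q x -> c <= f x) -> (side Q `^ d)%:E * c <= 2%:E * choquet d f.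
Proof.
move=> c0 cf.
have /= := @packing_choquet 1%R (fun Q => side Q `^ d)%R [set Q] (fun=> c) f ler01.
rewrite esum_set1; last by rewrite mule_ge0// lee_fin powR_ge0.
apply => //.
- by move=> P P' -> ->.
- split => [P _|P]; first by rewrite powR_ge0/=.
  have s0 : (0 <= side P `^ d)%R by rewrite powR_ge0.
  rewrite mul1r esum_mkcondr esum_set1; last by case: ifPn; rewrite ?lee_fin ?powR_ge0.
  case: ifPn; rewrite ?lee_fin// => /set_mem /= QP.
  have /andP[d0 _] := dn.
  apply: ge0_ler_powR; rewrite ?nnegrE ?(ltW (side_gt0 _)) ?(ltW d0)//.
  exact: side_le_of_subset.
- by move=> P x -> /cf.
Qed.

End content_packing.

(** * Young functions and Luxemburg averages *)

Section gauges.
Context {R : realType}.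
Implicit Types (Phi Psi : R -> \bar R).

(** The three properties of a Young function on which averages and their packing rely.  They
    are shared by [Phi] and by its complementary function, although the latter may vanish
    identically when [Phi] is infinite off the origin. *)
Record gauge Psi : Prop := Gauge {
  gauge_ge0 : forall t, (0 <= t)%R -> 0 <= Psi t;
  gauge_nd : forall s t, (0 <= s)%R -> (s <= t)%R -> Psi s <= Psi t;
  gauge_sub : forall a t, (0 <= a <= 1)%R -> (0 <= t)%R ->
    Psi (a * t)%R <= a%:E * Psi t }.

Lemma young_gauge Phi : young Phi -> gauge Phi.
Proof.
move=> yP; split; [exact: young_ge0|exact: young_nd|] => a t a01 t0.
by have := young_convex yP t0 (lexx 0%R) a01; rewrite mulr0 addr0 young0// mule0 adde0.
Qed.

Lemma nondecreasing_comp_measurable d (X : measurableType d) (D : set X) Psi (h : X -> R) :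
  (forall s t, (0 <= s)%R -> (s <= t)%R -> Psi s <= Psi t) ->
  (forall x, (0 <= h x)%R) -> measurable_fun D h ->
  measurable_fun D (fun x => Psi (h x)).
Proof.
move=> ndPsi h0 mh.
have E x : Psi (h x) = Psi (Num.max 0 (h x))%R by rewrite (max_idPr _).
rewrite (_ : (fun x => Psi (h x)) = (fun t => Psi (Num.max 0 t)%R) \o h); last first.
  by apply/funext => x; rewrite /= -E.
apply: measurableT_comp mh; apply: nondecreasing_emeasurable => // s t st.
apply: ndPsi; first by rewrite le_max lexx.
by rewrite ge_max le_max lexx /= le_max st orbT.
Qed.

Lemma gauge_measurable d (X : measurableType d) (D : set X) Psi (h : X -> R) :
  gauge Psi -> (forall x, (0 <= h x)%R) -> measurable_fun D h ->
  measurable_fun D (fun x => Psi (h x)).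
Proof. by move=> gP; apply: nondecreasing_comp_measurable; exact: gauge_nd. Qed.

(** Convexity through the origin.  The monotonicity is used below to see that the slope is
    a measurable function of its argument. *)
Lemma gauge_slope_nd Psi s t : gauge Psi -> (forall t, (0 <= t)%R -> Psi t < +oo) ->
  (0 <= s)%R -> (s <= t)%R -> (fine (Psi s) / s <= fine (Psi t) / t)%R.
Proof.
move=> gP Pfin s0 st; have t0 : (0 <= t)%R by exact: le_trans st.
have finE u : (0 <= u)%R -> Psi u = (fine (Psi u))%:E.
  by move=> u0; rewrite fineK// ge0_fin_numE ?Pfin// gauge_ge0.
have [->|sn0] := eqVneq s 0%R.
  by rewrite invr0 mulr0 divr_ge0// fine_ge0// gauge_ge0.
have sp : (0 < s)%R by rewrite lt_neqAle eq_sym sn0.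
have tp : (0 < t)%R by exact: lt_le_trans st.
have := gauge_sub gP (a := (s / t)%R) (t := t) _ t0.
rewrite divfK ?gt_eqF// (finE s)// (finE t)// => /(_ _)/wrap[].
  by rewrite divr_ge0//= ler_pdivrMr// mul1r.
rewrite -EFinM lee_fin ler_pdivrMr//.
by rewrite (_ : s / t * fine (Psi t) = fine (Psi t) / t * s)%R; last by ring.
Qed.

Lemma measurable_norm_div d (X : measurableType d) (D : set X) (f : X -> R) (l : R) :
  measurable_fun setT f -> measurable_fun D (fun x => `|f x| / l)%R.
Proof.
move=> mf; apply: measurable_funTS.
have mn := measurableT_comp (@normr_measurable R setT) mf.
by apply: (measurable_funM mn); exact: measurable_cst.
Qed.

Lemma measurable_norm_mul d (X : measurableType d) (D : set X) (f g : X -> R) :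
  measurable_fun setT f -> measurable_fun setT g ->
  measurable_fun D (fun x => `|f x * g x|%:E).
Proof.
move=> mf mg; apply: measurable_funTS; apply/measurable_EFinP.
exact: (measurableT_comp (@normr_measurable R setT) (measurable_funM mf mg)).
Qed.

Lemma complementary_ge0 Phi t : young Phi -> 0 <= complementary Phi t.
Proof.
move=> yP; apply: ereal_sup_ubound; exists 0%R => //=.
by rewrite mulr0 young0// sube0.
Qed.

Lemma complementary_gauge Phi : young Phi -> gauge (complementary Phi).
Proof.
move=> yP; split.
- by move=> t _; exact: complementary_ge0.
- move=> s t s0 st; apply: ge_ereal_sup => _ [u /= u0 <-].
  apply: (@le_trans _ _ ((t * u)%:E - Phi u)).
    by rewrite leeD2r// lee_fin ler_wpM2r.
  by apply: ereal_sup_ubound; exists u.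
- move=> a t /andP[a0 a1] t0; apply: ge_ereal_sup => _ [u /= u0 <-].
  apply: (@le_trans _ _ (a%:E * ((t * u)%:E - Phi u))); last first.
    by rewrite lee_wpmul2l ?lee_fin//; apply: ereal_sup_ubound; exists u.
  have := young_ge0 yP u0; case: (Phi u) => [r||//]; last first.
    by move=> _ /=; exact: leNye.
  rewrite lee_fin => r0; rewrite -!EFinB -EFinM lee_fin mulrBr mulrA lerB//.
  by rewrite ler_piMl.
Qed.

Lemma young_inequality Phi s t : young Phi -> (0 <= s)%R -> (0 <= t)%R ->
  (s * t)%:E <= Phi s + complementary Phi t.
Proof.
move=> yP s0 t0.
have : (t * s)%:E - Phi s <= complementary Phi t.
  by apply: ereal_sup_ubound; exists s.
have c0 := complementary_ge0 t yP.
have := young_ge0 yP s0; case: (Phi s) => [r r0|_ _|//].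
  by rewrite leeBlDl// mulrC.
by rewrite addye ?leey// -ltNye (lt_le_trans _ c0).
Qed.

(** The slope [Phi t / t] replaces the subgradient of [Phi] at [t], which would give equality in
    Young's inequality.  In the supremum defining the complementary function, the term
    [s * Phi t / t] is at most [Phi t] for [s <= t], and at most [Phi s] for [s > t] by
    convexity. *)
Lemma complementary_slope Phi t (r : R) : young Phi -> (0 <= t)%R -> Phi t = r%:E ->
  complementary Phi (r / t) <= r%:E.
Proof.
move=> yP t0 Pt; have r0 : (0 <= r)%R by have := young_ge0 yP t0; rewrite Pt.
apply: ge_ereal_sup => _ [s /= s0 <-]; have Ps0 := young_ge0 yP s0.
have [st|ts] := leP s t.
  apply: (@le_trans _ _ (r / t * s)%:E).
    by case: (Phi s) Ps0 => [q q0|_|//]; rewrite ?leNye// -EFinB lee_fin gerBl.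
  have [->|tn0] := eqVneq t 0%R; first by rewrite invr0 mulr0 mul0r lee_fin.
  rewrite lee_fin -mulrA ler_piMr// mulrC ler_pdivrMr ?mul1r//.
  by rewrite lt_neqAle eq_sym tn0.
apply: (@le_trans _ _ 0); last by rewrite lee_fin.
have sp : (0 < s)%R by exact: le_lt_trans ts.
have := gauge_sub (young_gauge yP) (a := (t / s)%R) (t := s) _ s0.
rewrite divfK ?gt_eqF// Pt => /(_ _)/wrap[].
  by rewrite divr_ge0//= ler_pdivrMr// mul1r ltW.
case: (Phi s) Ps0 => [q q0|_ _|//]; last by rewrite leNye.
rewrite -EFinM -EFinB !lee_fin => rq.
have [->|tn0] := eqVneq t 0%R; first by rewrite invr0 mulr0 mul0r sub0r oppr_le0.
have tp : (0 < t)%R by rewrite lt_neqAle eq_sym tn0.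
rewrite subr_le0 mulrAC ler_pdivrMr//.
by move: rq; rewrite mulrAC ler_pdivlMr// (mulrC t).
Qed.

(** Doubling carries an infinite value at [t] down to [t / 2], hence to arbitrarily small
    arguments. *)
Lemma young_delta2_dichotomy Phi : young Phi -> delta2 Phi ->
  (forall t, (0 <= t)%R -> Phi t < +oo) \/ (forall t, (0 < t)%R -> Phi t = +oo).
Proof.
move=> yP [K K1 PK].
have [fin|/existsNP[t0 /not_implyP[t00 /negP]]] := pselect (forall t, (0 <= t)%R -> Phi t < +oo).
  by left.
rewrite -leNgt leye_eq => /eqP Pt0; right => t tp.
have halve k s : (0 < s)%R -> Phi (2 ^+ k * s)%R = +oo -> Phi s = +oo.
  elim: k s => [s _|k ih s sp]; first by rewrite expr0 mul1r.
  rewrite exprS -mulrA => P2; apply: (ih _ sp).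
  have sp' : (0 < 2 ^+ k * s)%R by rewrite mulr_gt0// exprn_gt0.
  have := PK _ sp'; rewrite P2 leye_eq.
  have := young_ge0 yP (ltW sp'); case: (Phi _) => // r r0.
apply: (halve (Num.bound (t0 / t)) _ tp); apply/eqP; rewrite -leye_eq -Pt0.
apply: young_nd => //; rewrite -ler_pdivrMr//.
have ge0 : (0 <= t0 / t)%R by rewrite divr_ge0// ltW.
rewrite (le_trans (ltW (archi_boundP ge0)))//.
by rewrite -natrX ler_nat ltnW// ltn_expl.
Qed.

Lemma complementary_degenerate Phi t : young Phi ->
  (forall t, (0 < t)%R -> Phi t = +oo) -> complementary Phi t = 0.
Proof.
move=> yP Poo; apply/eqP; rewrite eq_le complementary_ge0// andbT.
apply: ge_ereal_sup => _ [s /= s0 <-].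
have [s_le0|/Poo->] := leP s 0%R; last by rewrite leNye.
by have -> : s = 0%R; [apply/eqP; rewrite eq_le s_le0 s0|rewrite mulr0 young0// sube0].
Qed.

End gauges.

Section luxemburg.
Context {R : realType} {n : nat}.
Local Notation X := (Rn R n).
Local Notation cube := (@cube R n).
Local Notation side := (@side R n).
Local Notation mu := (leb R n).
Implicit Types (P Q : dyadic n) (S T : set (dyadic n)) (Psi : R -> \bar R) (f g : X -> R).

Lemma luxemburgE Q (I : \bar R) :
  ((fine (mu (cube Q)))^-1%:E * I <= 1) = (I <= (side Q ^+ n)%:E).
Proof.
rewrite [X in fine X]leb_cube /= lee_pdivrMl; last by rewrite exprn_gt0 ?side_gt0.
by rewrite mule1.
Qed.

Lemma orlicz_avg_le Psi Q f (l : R) : (0 < l)%R ->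
  \int[mu]_(x in cube Q) Psi (`|f x| / l)%R <= (side Q ^+ n)%:E ->
  orlicz_avg Psi Q f <= l%:E.
Proof. by move=> l0 fl; apply: ereal_inf_lbound; exists l => //; split => //; rewrite luxemburgE. Qed.

Lemma orlicz_avg_ge0 Psi Q f : 0 <= orlicz_avg Psi Q f.
Proof. by apply: le_ereal_inf_tmp => _ [l [l0 _] <-]; rewrite lee_fin ltW. Qed.

Lemma le_orlicz_avg Psi Q f (c : \bar R) :
  (forall l, (0 < l)%R -> \int[mu]_(x in cube Q) Psi (`|f x| / l)%R <= (side Q ^+ n)%:E ->
    c <= l%:E) -> c <= orlicz_avg Psi Q f.
Proof. by move=> h; apply: le_ereal_inf_tmp => _ [l [l0 +] <-]; rewrite luxemburgE => /(h _ l0). Qed.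

Lemma orlicz_avg_fin_ex Psi Q f : orlicz_avg Psi Q f < +oo ->
  exists2 l, (0 < l)%R & \int[mu]_(x in cube Q) Psi (`|f x| / l)%R <= (side Q ^+ n)%:E.
Proof. by move=> /ereal_inf_ltP[_ [l [l0 fl] _] _]; exists l => //; rewrite -luxemburgE. Qed.

Lemma measurable_luxemburg Psi (D : set X) f (l : R) : gauge Psi -> measurable_fun setT f ->
  (0 < l)%R -> measurable_fun D (fun x => Psi (`|f x| / l)%R).
Proof.
move=> gP mf l0; apply: (gauge_measurable gP); first by move=> x; rewrite divr_ge0// ltW.
exact: measurable_norm_div.
Qed.

(** The normalized modular bounds the Luxemburg average: divide further by
    [A = 1 + (mean of the modular)] and use that a gauge is subhomogeneous.  Unlike the average,
    the right-hand side is additive in the cube. *)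
Lemma orlicz_avg_modular Psi Q f (l : R) : gauge Psi -> measurable_fun setT f -> (0 < l)%R ->
  \int[mu]_(x in cube Q) Psi (`|f x| / l)%R < +oo ->
  (side Q ^+ n)%:E * orlicz_avg Psi Q f <=
  l%:E * ((side Q ^+ n)%:E + \int[mu]_(x in cube Q) Psi (`|f x| / l)%R).
Proof.
move=> gP mf l0.
have arg0 x : (0 <= `|f x| / l)%R by rewrite divr_ge0// ltW.
have I0 : 0 <= \int[mu]_(x in cube Q) Psi (`|f x| / l)%R.
  by apply: integral_ge0 => x _; exact: gauge_ge0.
case IE : (\int[mu]_(x in cube Q) Psi (`|f x| / l)%R) I0 => [I|//|//] I0 _.
have s0 : (0 < side Q ^+ n)%R by rewrite exprn_gt0 ?side_gt0.
rewrite lee_fin in I0.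
pose A := (1 + I / side Q ^+ n)%R.
have A1 : (1 <= A)%R by rewrite lerDl divr_ge0// ltW.
have A0 : (0 < A)%R by exact: lt_le_trans A1.
have As : (A * side Q ^+ n = side Q ^+ n + I)%R.
  by rewrite /A mulrDl mul1r divfK ?gt_eqF.
rewrite -EFinD -EFinM -As (_ : l * _ = side Q ^+ n * (l * A))%R; last by ring.
rewrite [leRHS]EFinM lee_pmul2l ?fin_numE// ?lte_fin//.
apply: orlicz_avg_le; first exact: mulr_gt0.
apply: (@le_trans _ _ (\int[mu]_(x in cube Q) (A^-1%:E * Psi (`|f x| / l)%R))).
  apply: ge0_le_integral.
  - exact: measurable_cube.
  - by move=> x _; apply: (gauge_ge0 gP); rewrite divr_ge0// mulr_ge0// ltW.
  - by apply: measurable_luxemburg => //; exact: mulr_gt0.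
  - by apply: measurable_funeM; exact: measurable_luxemburg.
  - move=> x _; rewrite (_ : `|f x| / (l * A) = A^-1 * (`|f x| / l))%R; last first.
      by rewrite invfM; ring.
    by apply: (gauge_sub gP) => //; rewrite invr_ge0 (ltW A0)/= invf_le1.
rewrite ge0_integralZl_EFin ?IE.
- by rewrite -EFinM lee_fin mulrC ler_pdivrMr// mulrC As lerDr ltW.
- exact: measurable_cube.
- by move=> x _; exact: gauge_ge0.
- exact: measurable_luxemburg.
- by rewrite invr_ge0 ltW.
Qed.

(** Luxemburg averages are not additive, but volume times average is subadditive up to the
    factor 2: use one and the same [l], admissible for [P], on all the small cubes, sum the
    bounds of [orlicz_avg_modular], and let [l] decrease to the average over [P]. *)
Lemma orlicz_avg_packing Psi S P f : gauge Psi -> measurable_fun setT f ->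
  trivIset S cube -> (forall Q, S Q -> cube Q `<=` cube P) ->
  \esum_(Q in S) ((side Q ^+ n)%:E * orlicz_avg Psi Q f) <=
  2%:E * ((side P ^+ n)%:E * orlicz_avg Psi P f).
Proof.
move=> gP mf tS SP.
have sn0 Q : (0 < side Q ^+ n)%R by rewrite exprn_gt0 ?side_gt0.
rewrite muleA -EFinM -lee_pdivrMl ?mulr_gt0//.
apply: le_orlicz_avg => l l0 fl; rewrite lee_pdivrMl ?mulr_gt0//.
have arg0 x : 0 <= Psi (`|f x| / l)%R by apply: gauge_ge0 => //; rewrite divr_ge0// ltW.
have IQ0 Q : 0 <= \int[mu]_(x in cube Q) Psi (`|f x| / l)%R by exact: integral_ge0.
apply: (@le_trans _ _ (\esum_(Q in S)
    (l%:E * ((side Q ^+ n)%:E + \int[mu]_(x in cube Q) Psi (`|f x| / l)%R)))).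
  apply: le_esum => Q SQ; apply: orlicz_avg_modular => //.
  apply: le_lt_trans (ltry (side P ^+ n)); apply: le_trans fl.
  apply: ge0_subset_integral; [exact: measurable_cube|exact: measurable_cube| |by []|exact: SP].
  exact: measurable_luxemburg.
rewrite esumZl ?(ltW l0)//; last by move=> Q _; rewrite adde_ge0// lee_fin ltW.
rewrite [X in _ <= X]muleC lee_pmul2l ?lte_fin// mulr_natl mulr2n EFinD.
rewrite esumD//; last by move=> Q _; rewrite lee_fin ltW.
have int1 Q : \int[mu]_(x in cube Q) (1 : \bar R) = (side Q ^+ n)%:E.
  by rewrite integral_cst ?mul1e ?leb_cube//; exact: measurable_cube.
apply: leeD.
  rewrite -[leRHS]int1 -(eq_esum (fun Q _ => int1 Q)).
  by apply: esum_integral_le => // [Q|]; exact: measurable_cube.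
apply: le_trans fl; apply: esum_integral_le.
- exact: measurable_cube.
- exact: tS.
- exact: measurable_cube.
- exact: SP.
- exact: measurable_luxemburg.
- by move=> x _; exact: arg0.
Qed.

Lemma le_mul_orlicz_avg Psi Q f (c : \bar R) (k : R) : (0 < k)%R ->
  (forall l, (0 < l)%R -> \int[mu]_(x in cube Q) Psi (`|f x| / l)%R <= (side Q ^+ n)%:E ->
    c <= (k * l)%:E) -> c <= k%:E * orlicz_avg Psi Q f.
Proof.
move=> k0 h; rewrite -lee_pdivrMl//; apply: le_orlicz_avg => l l0 fl.
by rewrite lee_pdivrMl// -EFinM; exact: h.
Qed.

(** Both averages are finite here, so that the product of infima is the infimum of the
    products; at [a = 0] this needs an admissible [m] for [g]. *)
Lemma orlicz_hoelder Phi Q f g (a b : R) : young Phi ->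
  measurable_fun setT f -> measurable_fun setT g ->
  orlicz_avg Phi Q f = a%:E -> orlicz_avg (complementary Phi) Q g = b%:E ->
  \int[mu]_(x in cube Q) `|f x * g x|%:E <= (2 * (side Q ^+ n * (a * b)))%:E.
Proof.
move=> yP mf mg fa gb.
have sn0 : (0 < side Q ^+ n)%R by rewrite exprn_gt0 ?side_gt0.
have a0 : (0 <= a)%R by rewrite -lee_fin -fa orlicz_avg_ge0.
have gPhi := young_gauge yP; have gPsi := complementary_gauge yP.
have base l m : (0 < l)%R -> (0 < m)%R ->
  \int[mu]_(x in cube Q) Phi (`|f x| / l)%R <= (side Q ^+ n)%:E ->
  \int[mu]_(x in cube Q) complementary Phi (`|g x| / m)%R <= (side Q ^+ n)%:E ->
  \int[mu]_(x in cube Q) `|f x * g x|%:E <= ((2 * side Q ^+ n * m) * l)%:E.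
  move=> l0 m0 fl gm.
  have arg0 (h : X -> R) k x : (0 < k)%R -> (0 <= `|h x| / k)%R.
    by move=> k0; rewrite divr_ge0// ltW.
  apply: (@le_trans _ _ (\int[mu]_(x in cube Q) ((l * m)%:E *
      (Phi (`|f x| / l)%R + complementary Phi (`|g x| / m)%R)))).
    apply: ge0_le_integral.
    - exact: measurable_cube.
    - by move=> x _; rewrite lee_fin.
    - exact: measurable_norm_mul.
    - by apply: measurable_funeM; apply: emeasurable_funD; exact: measurable_luxemburg.
    - move=> x _; have := young_inequality yP (arg0 f l x l0) (arg0 g m x m0).
      have lm0 : 0 <= (l * m)%:E by rewrite lee_fin mulr_ge0// ltW.
      move=> /(lee_wpmul2l lm0); apply: le_trans.
      rewrite -EFinM lee_fin normrM.
      suff -> : (l * m * (`|f x| / l * (`|g x| / m)) = `|f x| * `|g x|)%R by [].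
      by field; rewrite !gt_eqF.
  rewrite ge0_integralZl_EFin.
  - rewrite ge0_integralD.
    + apply: (@le_trans _ _ ((l * m)%:E * ((side Q ^+ n)%:E + (side Q ^+ n)%:E))).
        by rewrite lee_wpmul2l ?leeD// lee_fin mulr_ge0// ltW.
      by rewrite -EFinD -EFinM lee_fin le_eqVlt; apply/orP; left; apply/eqP; ring.
    + exact: measurable_cube.
    + by move=> x _; apply: gauge_ge0 => //; exact: arg0.
    + exact: measurable_luxemburg.
    + by move=> x _; apply: gauge_ge0 => //; exact: arg0.
    + exact: measurable_luxemburg.
  - exact: measurable_cube.
  - by move=> x _; rewrite adde_ge0//; apply: gauge_ge0 => //; exact: arg0.
  - by apply: emeasurable_funD; exact: measurable_luxemburg.
  - by rewrite mulr_ge0// ltW.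
have half m : (0 < m)%R ->
  \int[mu]_(x in cube Q) complementary Phi (`|g x| / m)%R <= (side Q ^+ n)%:E ->
  \int[mu]_(x in cube Q) `|f x * g x|%:E <= (2 * side Q ^+ n * a * m)%:E.
  move=> m0 gm.
  rewrite [X in _ <= X](_ : _ = (2 * side Q ^+ n * m)%:E * a%:E); last first.
    by rewrite -EFinM; congr EFin; ring.
  rewrite -fa; apply: le_mul_orlicz_avg; first by rewrite !mulr_gt0.
  by move=> l lp fl; exact: base.
have [m m0 gm] : exists2 m, (0 < m)%R &
    \int[mu]_(x in cube Q) complementary Phi (`|g x| / m)%R <= (side Q ^+ n)%:E.
  by apply: orlicz_avg_fin_ex; rewrite gb ltry.
rewrite [X in _ <= X](_ : _ = (2 * side Q ^+ n * a)%:E * b%:E); last first.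
  by rewrite -EFinM; congr EFin; ring.
move: a0; rewrite le_eqVlt => /orP[/eqP a0|a0].
  by have := half m m0 gm; rewrite -!a0 !(mulr0, mul0r) mul0e.
rewrite -gb; apply: le_mul_orlicz_avg; first by rewrite !mulr_gt0.
by move=> l lp gl; exact: half.
Qed.

End luxemburg.

(** * Norming functions for Luxemburg averages *)

(** Monotone convergence: at each point the truncated integrand is eventually the full one.
    Cutting [u] off to zero, rather than capping it at [N], makes the truncation equal to [u]
    wherever it does not vanish, which [truncation_dual] exploits. *)
Lemma truncation_integral {R : realType} d (Y : measurableType d)
    (nu : {measure set Y -> \bar R}) (D : set Y) (Phi : R -> \bar R) (u : Y -> R) (c : \bar R) :
  gauge Phi -> measurable D -> measurable_fun setT u -> (forall x, (0 <= u x)%R) ->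
  c < \int[nu]_(x in D) Phi (u x) ->
  exists N : nat, c < \int[nu]_(x in D) Phi (u x * (u x <= N%:R)%R%:R)%R.
Proof.
move=> gP mD mu_ u0 cI.
pose g N x := Phi (u x * (u x <= N%:R)%R%:R)%R.
have arg0 N x : (0 <= u x * (u x <= N%:R)%R%:R)%R by rewrite mulr_ge0.
have mg N : measurable_fun D (g N).
  apply: (gauge_measurable gP (arg0 N)); apply: measurable_funTS.
  apply: (measurable_funM mu_).
  rewrite (_ : (fun x => _) = \1_[set x | (u x <= N%:R)%R]); last first.
    by apply/funext => x; rewrite indicE mem_setE.
  apply: measurable_indic; rewrite -[X in measurable X]setTI.
  rewrite (_ : [set x | _] = u @^-1` `]-oo, N%:R]%classic); last first.
    by apply/seteqP; split=> x /=; rewrite in_itv.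
  by apply: mu_ => //; exact: measurable_itv.
have g0 N x : 0 <= g N x by exact: gauge_ge0.
have gcvg x : g N x @[N --> \oo] --> Phi (u x).
  apply: cvg_near_cst; near=> N.
  rewrite /g (_ : (u x <= N%:R)%R = true) ?mulr1//.
  by near: N; exact: nbhs_infty_ger.
have gnd x : {homo g ^~ x : m k / (m <= k)%N >-> m <= k}.
  move=> m k mk; apply: gauge_nd => //; rewrite ler_wpM2l// ler_nat.
  have [um|] := boolP (u x <= m%:R)%R; last by [].
  by rewrite (le_trans um)// ler_nat.
have cvgI : \int[nu]_(x in D) g N x @[N --> \oo] --> \int[nu]_(x in D) Phi (u x).
  rewrite [X in _ --> X](_ : _ = \int[nu]_(x in D) limn (g ^~ x)); last first.
    by apply: eq_integral => x _; apply/esym/cvg_lim => //; exact: gcvg.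
  by apply: cvg_monotone_convergence.
apply: contrapT => nN; move: cI; apply/negP; rewrite -leNgt.
rewrite -(cvg_lim _ cvgI)//; apply: lime_le; first by apply/cvg_ex; eexists; exact: cvgI.
apply: nearW => N; rewrite leNgt; apply/negP => NI; apply: nN.
by exists N.
Unshelve. all: by end_near. Qed.

Section orlicz_dual.
Context {R : realType} {n : nat}.
Local Notation X := (Rn R n).
Local Notation cube := (@cube R n).
Local Notation side := (@side R n).
Local Notation mu := (leb R n).
Implicit Types (Q : dyadic n) (Phi : R -> \bar R) (f : X -> R).

(** In the degenerate case the complementary function vanishes, so any constant is admissible and
    it suffices that [f] does not vanish on the cube.  Indeed [Phi (|f| / a)] is [+oo * |f|],
    whose integral would be zero otherwise. *)
Lemma cst_dual Phi Q f (a : R) : young Phi -> (forall t, (0 < t)%R -> Phi t = +oo) ->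
  measurable_fun setT f -> (0 < a)%R -> a%:E < orlicz_avg Phi Q f ->
  exists2 M : R, (0 <= M)%R &
    (a * side Q ^+ n)%:E <= \int[mu]_(x in cube Q) (`|f x| * M)%:E.
Proof.
move=> yP Poo mf a0 af.
have sn0 : (0 < side Q ^+ n)%R by rewrite exprn_gt0 ?side_gt0.
have mf' : measurable_fun (cube Q) (fun x => `|f x|%:E).
  apply: measurable_funTS; apply/measurable_EFinP.
  exact: (measurableT_comp (@normr_measurable R setT) mf).
have IM M : (0 <= M)%R -> \int[mu]_(x in cube Q) (`|f x| * M)%:E =
    M%:E * \int[mu]_(x in cube Q) `|f x|%:E.
  move=> M0; rewrite -ge0_integralZl_EFin//; last exact: measurable_cube.
  by apply: eq_integral => x _; rewrite mulrC EFinM.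
have I0 : \int[mu]_(x in cube Q) `|f x|%:E != 0.
  apply: contraTN af => /eqP I0; rewrite -leNgt; apply: orlicz_avg_le => //.
  rewrite (_ : \int[mu]_(x in _) _ = \int[mu]_(x in cube Q) (+oo * `|f x|%:E)); last first.
    apply: eq_integral => x _; have [->|fx] := eqVneq (f x) 0%R.
      by rewrite normr0 mul0r mule0 young0.
    by rewrite Poo ?divr_gt0 ?normr_gt0// gt0_mulye ?lte_fin ?normr_gt0.
  rewrite ge0_integralZl//; last exact: measurable_cube.
  by rewrite I0 mule0 lee_fin ltW.
have : 0 <= \int[mu]_(x in cube Q) `|f x|%:E by apply: integral_ge0 => x _; rewrite lee_fin.
case IE : (\int[mu]_(x in cube Q) `|f x|%:E) I0 => [I| |//].
- rewrite eqe lee_fin => I0 I1.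
  exists (a * side Q ^+ n / I)%R; first by rewrite divr_ge0// mulr_ge0// ltW.
  rewrite IM ?IE -?EFinM ?divfK//.
  by rewrite divr_ge0// mulr_ge0// ltW.
- by exists 1%R => //; rewrite IM// IE mul1e leey.
Qed.

(** With [u] a truncation of [|f| / a] whose modular [I] is finite and exceeds the volume of [Q],
    and [J = I / |Q| > 1], the function [h = J^-1 * Phi u / u] works:
    [complementary_slope] bounds its modular by [J^-1 * I = |Q|], and
    [|f| * h = a * J^-1 * Phi u] integrates to [a * |Q|].  The truncation serves to make [I]
    finite. *)
Lemma truncation_dual Phi Q f (a : R) : young Phi ->
  (forall t, (0 <= t)%R -> Phi t < +oo) ->
  measurable_fun setT f -> (0 < a)%R -> a%:E < orlicz_avg Phi Q f ->
  exists h : X -> R, [/\ measurable_fun setT h, forall x, (0 <= h x)%R,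
    \int[mu]_(x in cube Q) complementary Phi (h x) <= (side Q ^+ n)%:E &
    (a * side Q ^+ n)%:E <= \int[mu]_(x in cube Q) (`|f x| * h x)%:E].
Proof.
move=> yP Pfin mf a0 af.
have sn0 : (0 < side Q ^+ n)%R by rewrite exprn_gt0 ?side_gt0.
have gP := young_gauge yP; have gPsi := complementary_gauge yP.
pose v x := (`|f x| / a)%R.
have v0 x : (0 <= v x)%R by rewrite divr_ge0// ltW.
have mv : measurable_fun setT v by exact: measurable_norm_div.
have : (side Q ^+ n)%:E < \int[mu]_(x in cube Q) Phi (v x).
  by rewrite ltNge; apply: contraTN af => vI; rewrite -leNgt; exact: orlicz_avg_le.
move=> /(truncation_integral gP (measurable_cube Q) mv v0)[N].
pose u x := (v x * (v x <= N%:R)%R%:R)%R.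
change ((side Q ^+ n)%:E < \int[mu]_(x in cube Q) Phi (u x) ->
  exists h : X -> R, [/\ measurable_fun setT h, forall x, (0 <= h x)%R,
    \int[mu]_(x in cube Q) complementary Phi (h x) <= (side Q ^+ n)%:E &
    (a * side Q ^+ n)%:E <= \int[mu]_(x in cube Q) (`|f x| * h x)%:E]).
have u0 x : (0 <= u x)%R by rewrite mulr_ge0.
have uN x : (u x <= N%:R)%R by rewrite /u; case: (boolP (v x <= N%:R)%R) => [vN|_]; rewrite ?mulr0 ?mulr1.
have mu_ : measurable_fun setT u.
  apply: (measurable_funM mv).
  rewrite (_ : (fun x => _) = \1_[set x | (v x <= N%:R)%R]); last first.
    by apply/funext => x; rewrite indicE mem_setE.
  apply: measurable_indic; rewrite -[X in measurable X]setTI.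
  rewrite (_ : [set x | _] = v @^-1` `]-oo, N%:R]%classic); last first.
    by apply/seteqP; split=> x /=; rewrite in_itv.
  by apply: mv => //; exact: measurable_itv.
have mPu : measurable_fun setT (fun x => Phi (u x)) by exact: gauge_measurable.
have Pu_fin x : Phi (u x) = (fine (Phi (u x)))%:E.
  by rewrite fineK// ge0_fin_numE ?Pfin// gauge_ge0.
have Pu0 x : (0 <= fine (Phi (u x)))%R by rewrite fine_ge0// gauge_ge0.
have I_fin : \int[mu]_(x in cube Q) Phi (u x) < +oo.
  apply: (@le_lt_trans _ _ (\int[mu]_(x in cube Q) Phi N%:R)).
    apply: ge0_le_integral.
    - exact: measurable_cube.
    - by move=> x _; exact: gauge_ge0.
    - exact: measurable_funTS.
    - exact: measurable_cst.
    - by move=> x _; exact: gauge_nd.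
  rewrite integral_cst; last exact: measurable_cube.
  by rewrite lte_mul_pinfty ?gauge_ge0 ?ge0_fin_numE ?Pfin ?gauge_ge0// leb_cube ltry.
case IE : (\int[mu]_(x in cube Q) Phi (u x)) I_fin => [I|//|] _; last first.
  by rewrite ltNge leNye.
rewrite lte_fin => sI; have I0 : (0 < I)%R by exact: lt_trans sI.
pose J := (I / side Q ^+ n)%R.
have J1 : (1 < J)%R by rewrite ltr_pdivlMr ?mul1r.
have J0 : (0 < J)%R by exact: lt_trans J1.
have Jinv : (0 <= J^-1 <= 1)%R by rewrite invr_ge0 (ltW J0)/= invf_le1// ltW.
have JI : (J^-1 * I = side Q ^+ n)%R.
  by rewrite /J invfM invrK; field; rewrite gt_eqF.
have intJ (k : R) : (0 <= k)%R -> \int[mu]_(x in cube Q) (k%:E * Phi (u x)) = (k * I)%:E.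
  move=> k0; rewrite ge0_integralZl_EFin ?IE; first by [].
  - exact: measurable_cube.
  - by move=> x _; exact: gauge_ge0.
  - exact: measurable_funTS.
  - exact: k0.
pose h x := (J^-1 * (fine (Phi (u x)) / u x))%R.
have slope0 x : (0 <= fine (Phi (u x)) / u x)%R by rewrite divr_ge0.
have h0 x : (0 <= h x)%R by rewrite mulr_ge0// invr_ge0 ltW.
have mh : measurable_fun setT h.
  have mslope : measurable_fun setT (fun x => (fine (Phi (u x)) / u x)%:E).
    apply: (nondecreasing_comp_measurable (Psi := fun t => (fine (Phi t) / t)%:E) _ u0 mu_).
    by move=> s t s0 st; rewrite lee_fin; exact: gauge_slope_nd.
  move/measurable_EFinP : mslope => mslope.
  by apply: measurable_funM; [exact: measurable_cst|exact: mslope].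
exists h; split => //.
- apply: (@le_trans _ _ (\int[mu]_(x in cube Q) ((J^-1)%:E * Phi (u x)))).
    apply: ge0_le_integral.
    + exact: measurable_cube.
    + by move=> x _; exact: gauge_ge0.
    + exact: (gauge_measurable gPsi h0 (measurable_funTS mh)).
    + by apply: measurable_funeM; exact: measurable_funTS.
    + move=> x _; apply: le_trans (gauge_sub gPsi Jinv (slope0 x)) _.
      rewrite lee_wpmul2l ?lee_fin ?invr_ge0 ?(ltW J0)// [X in _ <= X]Pu_fin.
      exact: complementary_slope.
  by rewrite intJ ?JI// invr_ge0 ltW.
- rewrite (_ : (a * _)%R%:E = \int[mu]_(x in cube Q) ((a * J^-1)%:E * Phi (u x))); last first.
    by rewrite intJ -?mulrA ?JI// mulr_ge0 ?invr_ge0 ?ltW.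
  apply: ge0_le_integral.
  + exact: measurable_cube.
  + move=> x _; apply: mule_ge0; last exact: gauge_ge0.
    by rewrite lee_fin mulr_ge0 ?invr_ge0 ?(ltW J0) ?(ltW a0).
  + by apply: measurable_funeM; exact: measurable_funTS.
  + have mn := measurableT_comp (@normr_measurable R setT) mf.
    by apply: measurable_funTS; apply/measurable_EFinP; exact: (measurable_funM mn mh).
  + move=> x _; have [ux|ux] := eqVneq (u x) 0%R.
      by rewrite ux young0// mule0 lee_fin mulr_ge0.
    have fE : (`|f x| = a * u x)%R.
      move: ux; rewrite /u; case: (v x <= N%:R)%R; rewrite ?mulr0 ?eqxx// mulr1 /v => _.
      by rewrite mulrC divfK ?gt_eqF.
    rewrite Pu_fin -EFinM lee_fin fE /h le_eqVlt; apply/orP; left; apply/eqP.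
    by field; rewrite ux gt_eqF.
Qed.

(** Luxemburg averages are normed, up to an arbitrarily small loss, by the functions in the unit
    ball of the complementary average.  The doubling condition excludes a [Phi] that is
    finite at one positive argument and infinite at another. *)
Lemma orlicz_dual Phi Q f (a : R) : young Phi -> delta2 Phi ->
  measurable_fun setT f -> (0 < a)%R -> a%:E < orlicz_avg Phi Q f ->
  exists h : X -> R, [/\ measurable_fun setT h, forall x, (0 <= h x)%R,
    \int[mu]_(x in cube Q) complementary Phi (h x) <= (side Q ^+ n)%:E &
    (a * side Q ^+ n)%:E <= \int[mu]_(x in cube Q) (`|f x| * h x)%:E].
Proof.
move=> yP dP mf a0 af.
case: (young_delta2_dichotomy yP dP) => [Pfin|Poo]; first exact: truncation_dual.
have [M M0 aM] := cst_dual yP Poo mf a0 af.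
exists (fun=> M); split => //.
rewrite (eq_integral (fun=> 0)).
  by rewrite integral0 lee_fin ltW// exprn_gt0 ?side_gt0.
by move=> x _; rewrite complementary_degenerate.
Qed.

End orlicz_dual.

(** * The full Morrey space against the block space *)

Section exponents.
Context {R : realType}.

Lemma le_poweR (x y : \bar R) (r : R) : (0 <= r)%R -> 0 <= x -> x <= y -> x `^ r <= y `^ r.
Proof.
move=> r0 x0 xy; apply: gt0_ler_poweR => //; rewrite in_itv/= leey andbT//.
exact: le_trans xy.
Qed.

Lemma hoelder_conjugate_gt1 (p : R) : (1 < p)%R ->
  hoelder_conjugate p%:E = (p / (p - 1))%:E.
Proof.
move=> p1; have p0 : (0 < p)%R by exact: lt_trans p1.
rewrite /hoelder_conjugate /= eqe gt_eqF// -EFinD inver subr_eq0 gt_eqF//.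
Qed.

Lemma conjugate_exponent (p : R) : (1 < p)%R ->
  (0 < p / (p - 1))%R /\ (p^-1 + (p / (p - 1))^-1 = 1)%R.
Proof.
move=> p1; have p0 : (0 < p)%R by exact: lt_trans p1.
have p10 : (0 < p - 1)%R by rewrite subr_gt0.
split; first by rewrite divr_gt0.
by field; rewrite !gt_eqF.
Qed.

(** Apply Young's inequality to [(a i / s) * b i] and sum; [s = M] gives the claim, and [s] slightly
    larger than [M] covers [M = 0] too. *)
Lemma esum_hoelder {I : countType} (A : set I) (m a b : I -> R) (p q K M : R) :
  (0 < p)%R -> (0 < q)%R -> (p^-1 + q^-1 = 1)%R ->
  (0 <= K)%R -> (0 <= M)%R ->
  (forall i, A i -> [/\ 0 <= m i, 0 <= a i & 0 <= b i]%R) ->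
  \esum_(i in A) (m i * a i `^ p)%:E <= (K * M `^ p)%:E ->
  \esum_(i in A) (m i * b i `^ q)%:E <= K%:E ->
  \esum_(i in A) (m i * (a i * b i))%:E <= (2 * K * M)%:E.
Proof.
move=> p0 q0 pq K0 M0 pos Ha Hb.
have p1 : (p^-1 <= 1)%R by rewrite -pq lerDl invr_ge0 ltW.
have q1 : (q^-1 <= 1)%R by rewrite -pq lerDr invr_ge0 ltW.
have bound (s : R) : (0 < s)%R -> (M <= s)%R ->
    \esum_(i in A) (m i * (a i * b i))%:E <= (2 * K * s)%:E.
  move=> s0 Ms.
  have sp0 : (0 < s `^ p)%R by exact: powR_gt0.
  apply: (@le_trans _ _ (\esum_(i in A)
      (s%:E * ((s `^ p)^-1%:E * (m i * a i `^ p)%:E + (m i * b i `^ q)%:E)))).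
    apply: le_esum => i Ai; have [m0 a0 b0] := pos i Ai.
    rewrite -(EFinM _ (m i * a i `^ p)) -EFinD -EFinM lee_fin.
    have as0 : (0 <= a i / s)%R by rewrite divr_ge0// ltW.
    have := conjugate_powR as0 b0 p0 q0 pq.
    have -> : ((a i / s) `^ p = a i `^ p / s `^ p)%R.
      by rewrite powRM// ?invr_ge0 ?ltW// -powR_inv1 ?ltW// -powRrM mulN1r powRN.
    move=> young_ab.
    have le1 : (a i / s * b i <= (s `^ p)^-1 * a i `^ p + b i `^ q)%R.
      apply: le_trans young_ab _; apply: lerD.
        by rewrite [X in (_ <= X)%R]mulrC ler_piMr// divr_ge0 ?powR_ge0.
      by rewrite ler_piMr// powR_ge0.
    have -> : (m i * (a i * b i) = s * (m i * (a i / s * b i)))%R.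
      by field; rewrite gt_eqF.
    rewrite ler_wpM2l ?(ltW s0)//.
    have -> : ((s `^ p)^-1 * (m i * a i `^ p) + m i * b i `^ q =
      m i * ((s `^ p)^-1 * a i `^ p + b i `^ q))%R by ring.
    by rewrite ler_wpM2l.
  have ge0a i : A i -> 0 <= (m i * a i `^ p)%:E.
    by move=> /pos[m0 _ _]; rewrite lee_fin mulr_ge0// powR_ge0.
  have ge0b i : A i -> 0 <= (m i * b i `^ q)%:E.
    by move=> /pos[m0 _ _]; rewrite lee_fin mulr_ge0// powR_ge0.
  have ge0a' i : A i -> 0 <= (s `^ p)^-1%:E * (m i * a i `^ p)%:E.
    by move=> Ai; rewrite mule_ge0 ?ge0a// lee_fin invr_ge0 ltW.
  rewrite esumZl ?(ltW s0)//; last by move=> i Ai; rewrite adde_ge0 ?ge0a' ?ge0b.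
  rewrite esumD// esumZl// ?invr_ge0 ?(ltW sp0)//.
  rewrite (_ : 2 * K * s = s * (K + K))%R; last by ring.
  rewrite EFinM lee_pmul2l ?fin_numE// ?lte_fin// EFinD leeD//.
  rewrite -[X in _ <= X]mul1e.
  apply: (@le_trans _ _ ((s `^ p)^-1%:E * (K * M `^ p)%:E)).
    by rewrite lee_wpmul2l// lee_fin invr_ge0 ltW.
  rewrite -!EFinM lee_fin mul1r ler_pdivrMl// mulrC ler_wpM2r//.
  by apply: ge0_ler_powR; rewrite ?nnegrE ?(ltW p0) ?(ltW s0).
apply/lee_addgt0Pr => e e0.
have K1 : (0 < 2 * K + 1)%R by rewrite ltr_wpDl// mulr_ge0.
have eK : (0 < e / (2 * K + 1))%R by rewrite divr_gt0.
apply: le_trans (bound (M + e / (2 * K + 1))%R _ _) _.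
- by rewrite ltr_wpDl.
- by rewrite lerDl ltW.
- rewrite -EFinD lee_fin mulrDr lerD2l mulrA ler_pdivrMr// mulrC.
  by rewrite ler_pM2l// lerDl.
Qed.

End exponents.

Section first_inequality.
Context {R : realType} {n : nat}.
Local Notation X := (Rn R n).
Local Notation cube := (@cube R n).
Local Notation side := (@side R n).
Local Notation mu := (leb R n).
Implicit Types (P Q : dyadic n) (S T : set (dyadic n)) (Psi Phi : R -> \bar R) (f g : X -> R).
Variable d : R.
Hypothesis n0 : (0 < n)%N.
Hypothesis dn : (0 < d < n%:R)%R.

Let dn' : (0 < d <= n%:R)%R.
Proof. by have /andP[-> /ltW ->] := dn. Qed.

Lemma choquet_norm1 (F : X -> \bar R) : (forall x, 0 <= F x) ->
  choquet_norm d 1 F = choquet d F.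
Proof.
move=> F0; rewrite /choquet_norm invr1 (_ : (fun x => _) = F).
  by rewrite poweRe1//; exact: choquet_ge0.
by apply/funext => x; rewrite gee0_abs// poweRe1.
Qed.

Lemma block_normE p Phi T f : block_norm d p Phi T f =
  choquet d (fun x => \esum_(Q in T) (orlicz_avg Phi Q f `^ p * (\1_(cube Q) x)%:E)) `^ p^-1.
Proof.
rewrite /block_norm choquet_norm1// => x; apply: esum_ge0 => Q _.
by rewrite mule_ge0 ?poweR_ge0// lee_fin.
Qed.

(** A lower bound, constant on [Q], of the maximal function on [Q].  It dominates the Morrey
    quantity of every cube containing [Q], which gives the packing of the weights below. *)
Definition ancestor_sup alpha Psi g Q : \bar R :=
  ereal_sup [set (side P `^ alpha)%:E * orlicz_avg Psi P g
            | P in [set P | cube Q `<=` cube P]].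

Lemma ancestor_sup_ge alpha Psi g P Q : cube Q `<=` cube P ->
  (side P `^ alpha)%:E * orlicz_avg Psi P g <= ancestor_sup alpha Psi g Q.
Proof. by move=> QP; apply: ereal_sup_ubound; exists P. Qed.

Lemma ancestor_sup_ge0 alpha Psi g Q : 0 <= ancestor_sup alpha Psi g Q.
Proof.
apply: le_trans (ancestor_sup_ge _ _ _ (@subset_refl _ (cube Q))).
by rewrite mule_ge0 ?orlicz_avg_ge0// lee_fin powR_ge0.
Qed.

Lemma ancestor_sup_le_frac_max alpha Psi g Q x : cube Q x ->
  ancestor_sup alpha Psi g Q <= frac_max alpha Psi g x.
Proof.
move=> Qx; apply: ge_ereal_sup => _ [P QP <-]; apply: ereal_sup_ubound; exists P => //.
by rewrite indicE mem_set ?mule1//; exact: QP.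
Qed.

Lemma frac_max_ge0 alpha Psi g x : 0 <= frac_max alpha Psi g x.
Proof.
apply: (@le_trans _ _ ((side (0%R, [tuple 0%R | i < n]) `^ alpha)%:E *
   orlicz_avg Psi (0%R, [tuple 0%R | i < n]) g * (\1_(cube (0%R, [tuple 0%R | i < n])) x)%:E)).
  by rewrite !mule_ge0 ?orlicz_avg_ge0// lee_fin ?powR_ge0.
by apply: ereal_sup_ubound; exists (0%R, [tuple 0%R | i < n]).
Qed.

Lemma ancestor_sup_le1 Psi g Q : morrey_norm d +oo Psi g <= 1 ->
  ancestor_sup (n%:R - d) Psi g Q <= 1.
Proof.
apply: le_trans; apply: le_ereal_inf_tmp => _ [t [t0 H0] <-].
rewrite leNgt; apply/negP => tQ.
have : (side Q `^ d)%:E <= 0.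
  rewrite -H0; apply: hcontent_cube_ge => // x Qx /=.
  by rewrite gee0_abs ?frac_max_ge0// (lt_le_trans tQ)// ancestor_sup_le_frac_max.
by rewrite lee_fin leNgt powR_gt0// side_gt0.
Qed.

Lemma morrey_norm_choquet (q : R) Psi g : (0 < q)%R -> morrey_norm d q%:E Psi g <= 1 ->
  choquet d (fun x => frac_max (n%:R - d) Psi g x `^ q) <= 1.
Proof.
move=> q0; rewrite /morrey_norm /choquet_norm.
rewrite (_ : (fun x => _) = (fun x => frac_max (n%:R - d) Psi g x `^ q)); last first.
  by apply/funext => x; rewrite gee0_abs// frac_max_ge0.
have := choquet_ge0 d (fun x => frac_max (n%:R - d) Psi g x `^ q).
case: (choquet _ _) => [c|_|//]; last by rewrite poweRyr// invr_eq0 gt_eqF.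
rewrite !lee_fin => c0 c1.
have -> : c = ((c `^ q^-1) `^ q)%R by rewrite -powRrM mulVf ?gt_eqF// powRr1.
have -> : 1%R = (1 `^ q)%R :> R by rewrite powR1.
by apply: ge0_ler_powR; rewrite ?nnegrE ?powR_ge0 ?(ltW q0).
Qed.

Lemma ancestor_sup_fin (q : R) Psi g Q : (0 < q)%R ->
  choquet d (fun x => frac_max (n%:R - d) Psi g x `^ q) <= 1 ->
  ancestor_sup (n%:R - d) Psi g Q < +oo.
Proof.
move=> q0 G1; rewrite ltey; apply/eqP => b_oo.
have := @choquet_cube_ge R n d n0 dn' Q (+oo)
  (fun x => frac_max (n%:R - d) Psi g x `^ q) (leey _).
move=> /(_ _)/wrap[x Qx|].
  have := ancestor_sup_le_frac_max (n%:R - d) Psi g Qx.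
  by rewrite b_oo leye_eq => /eqP ->; rewrite poweRyr// gt_eqF.
rewrite gt0_muley ?lte_fin ?powR_gt0 ?side_gt0// leye_eq => /eqP.
by apply/eqP; rewrite -ltey; apply: lte_mul_pinfty => //; rewrite (le_lt_trans G1) ?ltry.
Qed.

(** What remains of [side Q ^ d] times the Morrey quantity of [Q] once [ancestor_sup] is factored
    out.  Unlike the weights [side Q ^ d], these are packed. *)
Definition morrey_weight Psi g Q : R :=
  (side Q `^ d * fine ((side Q `^ (n%:R - d))%:E * orlicz_avg Psi Q g)
     / fine (ancestor_sup (n%:R - d) Psi g Q))%R.

Lemma side_split Q : (side Q ^+ n = side Q `^ d * side Q `^ (n%:R - d))%R.
Proof.
have s0 := @side_gt0 R n Q.
by rewrite -powRD ?subrKC ?powR_mulrn ?ltW// (gt_eqF s0) implybT.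
Qed.

Section weight.
Variables (Psi : R -> \bar R) (g : X -> R) (T : set (dyadic n)).
Hypothesis gP : gauge Psi.
Hypothesis mg : measurable_fun setT g.
Hypothesis fin_sup : forall Q, ancestor_sup (n%:R - d) Psi g Q < +oo.
Hypothesis tT : trivIset T cube.

Let v Q := fine ((side Q `^ (n%:R - d))%:E * orlicz_avg Psi Q g).
Let b Q := fine (ancestor_sup (n%:R - d) Psi g Q).

Let weightE Q : morrey_weight Psi g Q = (side Q `^ d * v Q / b Q)%R.
Proof. by []. Qed.

Let bE Q : ancestor_sup (n%:R - d) Psi g Q = (b Q)%:E.
Proof. by rewrite fineK// ge0_fin_numE// ancestor_sup_ge0. Qed.

Let v_ge0 Q : 0 <= (side Q `^ (n%:R - d))%:E * orlicz_avg Psi Q g.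
Proof. by rewrite mule_ge0 ?orlicz_avg_ge0// lee_fin powR_ge0. Qed.

Lemma morrey_avgE Q : (side Q `^ (n%:R - d))%:E * orlicz_avg Psi Q g = (v Q)%:E.
Proof.
rewrite fineK// ge0_fin_numE//.
by apply: le_lt_trans (fin_sup Q); exact: ancestor_sup_ge.
Qed.

Let vb P Q : cube Q `<=` cube P -> (v P <= b Q)%R.
Proof. by move=> QP; rewrite -lee_fin -morrey_avgE -bE; exact: ancestor_sup_ge. Qed.

Let v0 Q : (0 <= v Q)%R. Proof. by rewrite fine_ge0. Qed.
Let b0 Q : (0 <= b Q)%R. Proof. by rewrite fine_ge0// ancestor_sup_ge0. Qed.
Let sd0 Q : (0 < side Q `^ d)%R. Proof. by rewrite powR_gt0// side_gt0. Qed.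

(** Also true when the supremum is zero: then the Morrey quantity of [Q] is zero as well. *)
Lemma morrey_weight_mul Q : (morrey_weight Psi g Q * b Q = side Q `^ d * v Q)%R.
Proof.
rewrite weightE.
have [bQ0|bQ] := eqVneq (b Q) 0%R; last by rewrite divfK.
have := vb (@subset_refl _ (cube Q)); rewrite bQ0 => vQ.
by rewrite mulr0 (_ : v Q = 0%R) ?mulr0//; apply/eqP; rewrite eq_le vQ v0.
Qed.

(** The ratio is at most one.  For the cubes [Q] inside [P] the supremum is at least the Morrey
    quantity of [P], so the sum of the weights is at most
    [side P ^ n * avg P / (side P ^ (n - d) * avg P)] up to the factor 2 of
    [orlicz_avg_packing]. *)
Lemma morrey_weight_packing : packing d 2%R (morrey_weight Psi g) T.
Proof.
split => [Q TQ|P].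
  have w0 : (0 <= side Q `^ d * v Q / b Q)%R.
    by rewrite divr_ge0 ?mulr_ge0 ?(ltW (sd0 _)).
  apply/andP; split; first exact: w0.
  rewrite weightE.
  have [->|bQ] := eqVneq (b Q) 0%R; first by rewrite invr0 mulr0 ltW.
  rewrite ler_pdivrMr ?ler_pM2l//; first exact: vb.
  by rewrite lt_neqAle eq_sym bQ b0.
set S := T `&` _.
have tS : trivIset S cube by apply: sub_trivIset tT; exact: subIsetl.
have SP Q : S Q -> cube Q `<=` cube P by case.
have avgE Q : (side Q ^+ n)%:E * orlicz_avg Psi Q g = (side Q `^ d * v Q)%:E.
  by rewrite side_split EFinM -muleA morrey_avgE.
have := orlicz_avg_packing gP mg tS SP.
rewrite (eq_esum (fun Q _ => avgE Q)) avgE -EFinM => pack.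
have ge0 Q : S Q -> 0 <= (side Q `^ d * v Q)%:E.
  by move=> _; rewrite lee_fin mulr_ge0// ltW.
have [vP0|vP] := eqVneq (v P) 0%R.
  rewrite esum1 ?lee_fin ?mulr_ge0 ?(ltW (sd0 _))// => Q SQ.
  have := le_trans (esum_ge_term SQ ge0) pack.
  rewrite vP0 !mulr0 lee_fin pmulr_rle0// => vQ.
  have vQ0 : v Q = 0%R by apply/eqP; rewrite eq_le vQ v0.
  by rewrite weightE vQ0 mulr0 mul0r.
have vP1 : (0 < v P)%R by rewrite lt_neqAle eq_sym vP v0.
apply: (@le_trans _ _ (\esum_(Q in S) ((v P)^-1%:E * (side Q `^ d * v Q)%:E))).
  apply: le_esum => Q SQ; rewrite -EFinM lee_fin mulrC.
  have bvP := vb (SP _ SQ); rewrite weightE; apply: ler_wpM2l.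
    by rewrite mulr_ge0 ?(ltW (sd0 _)).
  by rewrite lef_pV2 ?posrE// (lt_le_trans vP1).
rewrite esumZl ?invr_ge0 ?(ltW vP1)//.
rewrite lee_pdivrMl// -EFinM; apply: le_trans pack _.
by rewrite lee_fin le_eqVlt; apply/orP; left; apply/eqP; ring.
Qed.

End weight.

(** Hoelder on each cube of the tiling, then the exact factorization of [side Q ^ d] times the
    Morrey quantity into weight times supremum. *)
Lemma pairing_le Phi T f g : young Phi -> tiling (R := R) T ->
  measurable_fun setT f -> measurable_fun setT g ->
  (forall Q, ancestor_sup (n%:R - d) (complementary Phi) g Q < +oo) ->
  (forall Q, T Q -> orlicz_avg Phi Q f < +oo) ->
  \int[mu]_x `|f x * g x|%:E <= 2%:E *
    \esum_(Q in T) (morrey_weight (complementary Phi) g Q *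
      (fine (orlicz_avg Phi Q f) * fine (ancestor_sup (n%:R - d) (complementary Phi) g Q)))%:E.
Proof.
move=> yP tT mf mg fs ff.
set Psi := complementary Phi in fs *.
rewrite (@integral_partition _ _ _ _ mu cube T measurable_cube (tiling_trivIset tT)); first last.
- by move=> x; rewrite lee_fin.
- exact: measurable_norm_mul.
- by move=> x; exact: tiling_cover.
have wE Q : (morrey_weight Psi g Q *
      (fine (orlicz_avg Phi Q f) * fine (ancestor_sup (n%:R - d) Psi g Q)) =
    side Q `^ d * fine ((side Q `^ (n%:R - d))%:E * orlicz_avg Psi Q g) * fine (orlicz_avg Phi Q f))%R.
  by rewrite -(morrey_weight_mul fs); ring.
rewrite -esumZl//; last first.
  move=> Q _; rewrite wE lee_fin mulr_ge0 ?fine_ge0 ?orlicz_avg_ge0// mulr_ge0 ?powR_ge0//.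
  by rewrite fine_ge0// mule_ge0 ?orlicz_avg_ge0// lee_fin powR_ge0.
apply: le_esum => Q TQ.
have aE : orlicz_avg Phi Q f = (fine (orlicz_avg Phi Q f))%:E.
  by rewrite fineK// ge0_fin_numE ?ff// orlicz_avg_ge0.
have s0 : (0 < side Q `^ (n%:R - d))%R by rewrite powR_gt0// side_gt0.
have gE : orlicz_avg Psi Q g = (fine (orlicz_avg Psi Q g))%:E.
  rewrite fineK// ge0_fin_numE ?orlicz_avg_ge0// ltey; apply/eqP => goo.
  by have := morrey_avgE fs Q; rewrite goo gt0_muley ?lte_fin.
apply: le_trans (orlicz_hoelder yP mf mg aE gE) _.
rewrite -EFinM lee_fin ler_pM2l// wE -/Psi gE -EFinM /= side_split le_eqVlt.
by apply/orP; left; apply/eqP; ring.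
Qed.

(** The weights are packed, so [packing_choquet] bounds the two factors that Hoelder's inequality
    for sums produces: the power sum of the averages of [f] by the block norm, and the power sum
    of the ancestor suprema of [g] by the Choquet integral of the maximal function.  For [p = 1] the
    suprema are at most one, and only the first factor remains. *)
Lemma associate_morrey_le_block p Phi T f : (1 <= p)%R -> young Phi -> tiling (R := R) T ->
  measurable_fun setT f ->
  associate_norm (morrey_norm d (hoelder_conjugate p%:E) (complementary Phi)) f
    <= 12%:E * block_norm d p Phi T f.
Proof.
move=> p1 yP tT mf; rewrite block_normE.
have p0 : (0 < p)%R by exact: lt_le_trans p1.
have tT' := tiling_trivIset tT.
set F := fun x : X => _; set Psi := complementary Phi.
have gPsi : gauge Psi by exact: complementary_gauge.
have FE Q x : T Q -> cube Q x -> F x = orlicz_avg Phi Q f `^ p.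
  move=> TQ Qx.
  by rewrite /F (esum_indic_disjoint (a := fun Q => orlicz_avg Phi Q f `^ p) tT' TQ Qx)// => *; exact: poweR_ge0.
have := choquet_ge0 d F; case cE : (choquet d F) => [c||//]; last first.
  by move=> _; rewrite poweRyr ?invr_eq0 ?gt_eqF// gt0_muley ?lte_fin// leey.
rewrite lee_fin => c0.
have ff Q : T Q -> orlicz_avg Phi Q f < +oo.
  move=> TQ; rewrite ltey; apply/eqP => foo.
  have := @choquet_cube_ge R n d n0 dn' Q (+oo) F (leey _).
  move=> /(_ _)/wrap[x Qx|]; first by rewrite (FE Q x TQ Qx) foo poweRyr ?gt_eqF.
  by rewrite cE gt0_muley ?lte_fin ?powR_gt0 ?side_gt0// leye_eq => /eqP.
pose a Q := fine (orlicz_avg Phi Q f).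
have aE Q : T Q -> orlicz_avg Phi Q f = (a Q)%:E.
  by move=> TQ; rewrite fineK// ge0_fin_numE ?ff// orlicz_avg_ge0.
have a0 Q : (0 <= a Q)%R by rewrite fine_ge0// orlicz_avg_ge0.
apply: ge_ereal_sup => _ [g [mg gN] <-].
suff [fs le6] : (forall Q, ancestor_sup (n%:R - d) Psi g Q < +oo) /\
    \esum_(Q in T) (morrey_weight Psi g Q * (a Q * fine (ancestor_sup (n%:R - d) Psi g Q)))%:E
      <= 6%:E * c%:E `^ p^-1.
  apply: le_trans (pairing_le yP tT mf mg fs ff) _.
  (* The 2 is the constant of Hoelder's inequality for Luxemburg averages; the 6 is twice the
     constant 3 = 2 + 1 of [packing_choquet]. *)
  have -> : 12%:E = 2%:E * 6%:E :> \bar R by rewrite -EFinM -natrM.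
  by rewrite -muleA lee_wpmul2l ?lee_fin.
have packF m : packing d 2%R m T -> \esum_(Q in T) ((m Q)%:E * (a Q `^ p)%:E) <= 3%:E * c%:E.
  move=> pm; rewrite -cE.
  have -> : 3%:E = (2 + 1)%:E :> \bar R by rewrite -natr1.
  apply: (packing_choquet n0 dn' _ tT' pm) => //.
    by move=> Q TQ; rewrite lee_fin powR_ge0.
  by move=> Q x TQ Qx; rewrite (FE Q x TQ Qx) aE.
move: p1; rewrite le_eqVlt => /orP[/eqP p1|p1].
  move: gN; rewrite -p1 hoelder_conjugate1 => gN.
  have b1 Q := ancestor_sup_le1 Q gN.
  have fs Q : ancestor_sup (n%:R - d) Psi g Q < +oo by rewrite (le_lt_trans (b1 Q)) ?ltry.
  have pm := morrey_weight_packing gPsi mg fs tT'; split => //.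
  rewrite invr1 poweRe1 ?lee_fin//.
  apply: le_trans (_ : 3%:E * c%:E <= _); last by rewrite -!EFinM lee_fin ler_wpM2r// ler_nat.
  apply: le_trans (packF _ pm); apply: le_esum => Q TQ.
  have [/(_ _ TQ)/andP[w0 _] _] := pm.
  rewrite -EFinM lee_fin ler_wpM2l// -p1 powRr1// ler_piMr//.
  by rewrite -lee_fin fineK// ge0_fin_numE ?fs// ancestor_sup_ge0.
have [q0 pq] := conjugate_exponent p1; set q := (p / (p - 1))%R in q0 pq.
move: gN; rewrite hoelder_conjugate_gt1// -/q => /(morrey_norm_choquet q0) gN.
have fs Q := ancestor_sup_fin Q q0 gN; split => //.
have pm := morrey_weight_packing gPsi mg fs tT'.
have w0 Q : T Q -> (0 <= morrey_weight Psi g Q)%R.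
  by move=> TQ; have [/(_ _ TQ)/andP[]] := pm.
have -> : 6%:E * c%:E `^ p^-1 = (2 * 3 * c `^ p^-1)%:E :> \bar R.
  by rewrite poweR_EFin -EFinM -natrM.
apply: (esum_hoelder p0 q0 pq) => //.
- by rewrite powR_ge0.
- by move=> Q TQ; rewrite w0// a0 fine_ge0// ancestor_sup_ge0.
- rewrite -powRrM mulVf ?gt_eqF// powRr1//.
  by rewrite EFinM; apply: le_trans (packF _ pm); apply: le_esum => Q TQ; rewrite EFinM.
apply: (@le_trans _ _ (3%:E * choquet d (fun x => frac_max (n%:R - d) Psi g x `^ q))); last first.
  by rewrite -[leRHS]mule1 lee_wpmul2l// lee_fin.
have -> : 3%:E = (2 + 1)%:E :> \bar R by rewrite -natr1.
apply: (@le_trans _ _ (\esum_(Q in T) ((morrey_weight Psi g Q)%:E *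
   ancestor_sup (n%:R - d) Psi g Q `^ q))).
  apply: le_esum => Q TQ.
  rewrite -{2}(@fineK _ (ancestor_sup (n%:R - d) Psi g Q)) ?EFinM//.
  by rewrite ge0_fin_numE ?fs// ancestor_sup_ge0.
apply: (packing_choquet n0 dn' _ tT' pm) => //.
  by move=> Q TQ; exact: poweR_ge0.
move=> Q x TQ Qx; apply: le_poweR; [exact: ltW|exact: ancestor_sup_ge0|].
exact: ancestor_sup_le_frac_max.
Qed.

End first_inequality.

(** * The block space against the tiled Morrey space *)

Section second_inequality.
Context {R : realType} {n : nat}.
Local Notation X := (Rn R n).
Local Notation cube := (@cube R n).
Local Notation side := (@side R n).
Local Notation mu := (leb R n).
Implicit Types (P Q : dyadic n) (S T : set (dyadic n)) (Psi Phi : R -> \bar R) (f g : X -> R).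
Variable d : R.

Lemma orlicz_avg_eq0 Psi Q g : Psi 0%R = 0 -> (forall x, cube Q x -> g x = 0%R) ->
  orlicz_avg Psi Q g = 0.
Proof.
move=> P0 g0; apply/eqP; rewrite eq_le orlicz_avg_ge0 andbT.
apply/lee_addgt0Pr => e e0; rewrite add0e; apply: orlicz_avg_le => //.
rewrite (eq_integral (fun=> 0)).
  by rewrite integral0 lee_fin exprn_ge0// ltW// side_gt0.
by move=> x /set_mem Qx; rewrite g0// normr0 mul0r.
Qed.

Lemma complementary0 Phi : young Phi -> complementary Phi 0%R = 0.
Proof.
move=> yP; apply/eqP; rewrite eq_le complementary_ge0// andbT.
apply: ge_ereal_sup => _ [s /= s0 <-]; rewrite mul0r sub0e leeNl oppe0.
exact: young_ge0.
Qed.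

Lemma morrey_tiling_norm_finE (q : R) Psi T g : morrey_tiling_norm d q%:E Psi T g =
  choquet d (fun x => \esum_(Q in T)
    (((side Q `^ (n%:R - d))%:E * orlicz_avg Psi Q g) `^ q * (\1_(cube Q) x)%:E)) `^ q^-1.
Proof.
rewrite /morrey_tiling_norm choquet_norm1// => x; apply: esum_ge0 => Q _.
by rewrite mule_ge0 ?poweR_ge0// lee_fin.
Qed.

Lemma morrey_tiling_norm_le1 p Psi T S g (k : dyadic n -> R) : (1 <= p)%R ->
  tiling (R := R) T -> S `<=` T ->
  (forall Q, S Q -> (0 <= k Q)%R) ->
  (forall Q, S Q -> (side Q `^ (n%:R - d))%:E * orlicz_avg Psi Q g <= (k Q)%:E) ->
  (forall Q, T Q -> ~ S Q -> orlicz_avg Psi Q g = 0) ->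
  (p = 1%R -> forall Q, S Q -> (k Q <= 1)%R) ->
  ((1 < p)%R -> \esum_(Q in S) (side Q `^ d * k Q `^ (p / (p - 1)))%:E <= 1) ->
  morrey_tiling_norm d (hoelder_conjugate p%:E) Psi T g <= 1.
Proof.
move=> p1 tT ST k0 kS gS k1 kq.
have tT' := tiling_trivIset tT.
have v0 Q : 0 <= (side Q `^ (n%:R - d))%:E * orlicz_avg Psi Q g.
  by rewrite mule_ge0 ?orlicz_avg_ge0// lee_fin powR_ge0.
move: p1; rewrite le_eqVlt => /orP[/eqP p1|p1].
  rewrite -p1 hoelder_conjugate1; apply: ge_ereal_sup => _ [Q TQ <-].
  have [SQ|nSQ] := pselect (S Q); last by rewrite gS// mule0 lee_fin.
  by apply: le_trans (kS _ SQ) _; rewrite lee_fin k1.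
rewrite hoelder_conjugate_gt1// morrey_tiling_norm_finE.
have [q0 _] := conjugate_exponent p1; set q := (p / (p - 1))%R in q0 kq *.
rewrite -(poweR1r q^-1); apply: le_poweR; [by rewrite invr_ge0 ltW|exact: choquet_ge0|].
pose c Q := if Q \in S then (k Q `^ q)%:E else 0 : \bar R.
apply: (@le_trans _ _ (\esum_(Q in T) ((side Q `^ d)%:E * c Q))); last first.
  apply: le_trans (kq p1); rewrite -[S in leRHS](setIidr ST) esum_mkcondr.
  by apply: le_esum => Q TQ; rewrite /c; case: ifPn; rewrite ?mule0.
apply: choquet_le_esum => [Q TQ|x].
  by rewrite /c; case: ifPn => // _; rewrite lee_fin powR_ge0.
have [Q TQ Qx] := tiling_cover x tT; exists Q => //; split => //.
rewrite (esum_indic_disjoint (a := fun Q => ((side Q `^ (n%:R - d))%:E * orlicz_avg Psi Q g) `^ q) tT' TQ Qx);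
  last by move=> *; exact: poweR_ge0.
rewrite /c; case: ifPn => [/set_mem SQ|/negP nSQ].
  rewrite -(poweR_EFin (k Q) q); apply: le_poweR; [exact: ltW|exact: v0|exact: kS].
by rewrite gS ?mule0 ?poweR0r ?gt_eqF// => /mem_set.
Qed.

Lemma associate_norm_ge N f g : measurable_fun setT g -> N g <= 1 ->
  \int[mu]_x `|f x * g x|%:E <= associate_norm N f.
Proof. by move=> mg Ng; apply: ereal_sup_ubound; exists g. Qed.

(** Test with [g] equal to a multiple of a norming function of [f] on each cube of [S].  The
    coefficients [k] are the extremal ones in Hoelder's inequality for the weights [side Q ^ d].
    The norm of [g] only sees the cubes of the tiling, and is at most the corresponding
    weighted power sum of [k] by [choquet_le_esum]. *)
Lemma associate_tiling_ge p Phi T S f (a : dyadic n -> R) (A : R) : (1 <= p)%R ->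
  young Phi -> delta2 Phi -> tiling (R := R) T -> measurable_fun setT f -> S `<=` T ->
  (forall Q, S Q -> (0 < a Q)%R /\ (a Q)%:E < orlicz_avg Phi Q f) ->
  \esum_(Q in S) (side Q `^ d * a Q `^ p)%:E = A%:E ->
  (A `^ p^-1)%:E <=
    associate_norm (morrey_tiling_norm d (hoelder_conjugate p%:E) (complementary Phi) T) f.
Proof.
move=> p1 yP dP tT mf ST aS AE.
have p0 : (0 < p)%R by exact: lt_le_trans p1.
have tT' := tiling_trivIset tT.
have tS : trivIset S cube by exact: sub_trivIset tT'.
have gPsi := complementary_gauge yP; set Psi := complementary Phi in gPsi *.
have sr0 (r : R) Q : (0 < side Q `^ r)%R by rewrite powR_gt0// side_gt0.
have terms0 Q : S Q -> 0 <= (side Q `^ d * a Q `^ p)%:E.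
  by move=> _; rewrite lee_fin mulr_ge0// powR_ge0.
have A0 : (0 <= A)%R by rewrite -lee_fin -AE; exact: esum_ge0.
have A_gt0 Q : S Q -> (0 < A)%R.
  move=> SQ; rewrite -lte_fin -AE; apply: lt_le_trans (esum_ge_term SQ terms0).
  by rewrite lte_fin mulr_gt0// powR_gt0; have [] := aS Q SQ.
have /choice[h hP] : forall Q, exists h : X -> R, S Q ->
    [/\ measurable_fun setT h, forall x, (0 <= h x)%R,
    \int[mu]_(x in cube Q) Psi (h x) <= (side Q ^+ n)%:E &
    (a Q * side Q ^+ n)%:E <= \int[mu]_(x in cube Q) (`|f x| * h x)%:E].
  move=> Q; have [SQ|nSQ] := pselect (S Q); last by exists (fun=> 0%R).
  have [a0 af] := aS Q SQ.
  by have [h hP] := orlicz_dual yP dP mf a0 af; exists h.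
(* For [p = 1] this coefficient is [1]; for [p > 1] its conjugate power is [a Q ^ p / A]. *)
pose k Q := (a Q `^ (p - 1) / A `^ (1 - p^-1))%R.
have k_gt0 Q : S Q -> (0 < k Q)%R.
  by move=> SQ; have [a0 _] := aS Q SQ; rewrite divr_gt0// powR_gt0// (A_gt0 Q).
pose s Q := (k Q / side Q `^ (n%:R - d))%R.
have s_gt0 Q : S Q -> (0 < s Q)%R by move=> SQ; rewrite divr_gt0// k_gt0.
pose u Q x := (s Q * h Q x)%R.
have u0 Q x : S Q -> (0 <= u Q x)%R.
  by move=> SQ; have [_ h0 _ _] := hP Q SQ; rewrite mulr_ge0// ltW// s_gt0.
pose g := piecewise S cube u.
have gE Q x : S Q -> cube Q x -> g x = u Q x.
  by move=> SQ Qx; exact: piecewise_in.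
have mg : measurable_fun setT g.
  apply: measurable_piecewise; [exact: measurable_cube| |exact: u0].
  move=> Q SQ; have [mh _ _ _] := hP Q SQ.
  by apply: measurable_funM; [exact: measurable_cst|exact: mh].
have gN : morrey_tiling_norm d (hoelder_conjugate p%:E) Psi T g <= 1.
  apply: (@morrey_tiling_norm_le1 p Psi T S g k) => //.
  - by move=> Q SQ; rewrite ltW// k_gt0.
  - move=> Q SQ; have [_ h0 hI _] := hP Q SQ.
    have -> : (k Q)%:E = (side Q `^ (n%:R - d))%:E * (s Q)%:E.
      by rewrite -EFinM mulrC divfK// gt_eqF.
    apply: lee_wpmul2l; first by rewrite lee_fin ltW.
    apply: orlicz_avg_le; first exact: s_gt0.
    apply: le_trans hI; rewrite le_eqVlt; apply/orP; left; apply/eqP.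
    apply: eq_integral => x /set_mem Qx; congr Psi.
    by rewrite (gE Q)// ger0_norm ?u0// /u mulrC mulKf// gt_eqF// s_gt0.
  - move=> Q TQ nSQ; apply: orlicz_avg_eq0; first exact: complementary0.
    move=> x Qx; apply: piecewise_notin => P SP Px; apply: nSQ.
    by rewrite -(tT' P Q (ST _ SP) TQ) //; exists x.
  - by move=> pE Q SQ; rewrite /k pE subrr invr1 subrr !powRr0 divr1.
  move=> p_gt1; have [q0 pq] := conjugate_exponent p_gt1.
  set q := (p / (p - 1))%R in q0 pq *.
  have [[Q0 SQ0]|S0] := pselect (exists Q, S Q); last first.
    rewrite esum1 ?lee_fin// => Q SQ.
    by exfalso; apply: S0; exists Q.
  have Ap := A_gt0 Q0 SQ0.
  rewrite (_ : \esum_(Q in S) _ = \esum_(Q in S) (A^-1%:E * (side Q `^ d * a Q `^ p)%:E)).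
    by rewrite esumZl ?AE ?invr_ge0// -EFinM lee_fin mulVf// gt_eqF.
  apply: eq_esum => Q SQ; have [a0 _] := aS Q SQ.
  have -> : (k Q `^ q = a Q `^ p / A)%R.
    rewrite /k -powRN powRM ?powR_ge0// -!powRrM.
    have -> : ((p - 1) * q = p)%R by rewrite /q; field; rewrite subr_eq0 gt_eqF.
    have -> : (- (1 - p^-1) * q = -1)%R.
      by rewrite /q; field; rewrite subr_eq0 !gt_eqF.
    by rewrite powR_inv1// ltW.
  by rewrite -EFinM; congr EFin; ring.
apply: le_trans (associate_norm_ge f mg gN).
rewrite (@integral_partition _ _ _ _ mu cube T measurable_cube tT'); first last.
- by move=> x; rewrite lee_fin.
- exact: measurable_norm_mul.
- by move=> x; exact: tiling_cover.
apply: (@le_trans _ _ (\esum_(Q in S) \int[mu]_(x in cube Q) `|f x * g x|%:E)); last first.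
  by apply: le_esum_subset => // Q TQ; apply: integral_ge0 => x _; rewrite lee_fin.
have c0 : (0 <= (A `^ (1 - p^-1))^-1)%R by rewrite invr_ge0 powR_ge0.
apply: (@le_trans _ _ (\esum_(Q in S) ((A `^ (1 - p^-1))^-1%:E * (side Q `^ d * a Q `^ p)%:E))).
  rewrite esumZl// AE -EFinM lee_fin.
  have [->|An0] := eqVneq A 0%R; first by rewrite mulr0 powR0// invr_eq0 gt_eqF.
  have Ap : (0 < A)%R by rewrite lt_neqAle eq_sym An0.
  rewrite -powRN -[X in (_ <= _ * X)%R]powRr1// -powRD ?An0 ?implybT//.
  by rewrite (_ : - (1 - p^-1) + 1 = p^-1)%R //; ring.
apply: le_esum => Q SQ; have [mh h0 _ hI] := hP Q SQ; have [a0 _] := aS Q SQ.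
have mfh : measurable_fun (cube Q) (fun x => (`|f x| * h Q x)%:E).
  apply: measurable_funTS; apply/measurable_EFinP.
  exact: (measurable_funM (measurableT_comp (@normr_measurable R setT) mf) mh).
rewrite (_ : \int[mu]_(x in cube Q) _ = (s Q)%:E * \int[mu]_(x in cube Q) (`|f x| * h Q x)%:E).
  apply: (@le_trans _ _ ((s Q)%:E * (a Q * side Q ^+ n)%:E)); last first.
    by rewrite lee_wpmul2l// lee_fin ltW// s_gt0.
  rewrite -!EFinM lee_fin le_eqVlt; apply/orP; left; apply/eqP.
  rewrite (side_split d) /s /k.
  have -> : (a Q `^ p = a Q * a Q `^ (p - 1))%R.
    rewrite -{2}[a Q]powRr1 ?ltW// -powRD ?(gt_eqF a0) ?implybT//.
    by rewrite subrKC.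
  field; rewrite gt_eqF//= gt_eqF// powR_gt0//.
  exact: A_gt0 SQ.
rewrite -ge0_integralZl_EFin.
- by apply: eq_integral => x /set_mem Qx; rewrite (gE Q)// -EFinM normrM (ger0_norm (u0 _ _ SQ)) /u mulrCA.
- exact: measurable_cube.
- by move=> x _; rewrite lee_fin mulr_ge0.
- exact: mfh.
- by rewrite ltW// s_gt0.
Qed.

Hypothesis n0 : (0 < n)%N.
Hypothesis dn : (0 < d < n%:R)%R.

(** By [choquet_le_esum] the block norm is at most the weighted power sum of the averages over the
    tiling, that is, the supremum of its finite subsums, and each of those is tested by
    [associate_tiling_ge].  Halving the averages makes them strictly smaller than the true ones.
    An infinite average is tested on its own, with arbitrarily large numbers below it. *)
Lemma block_le_associate_tiling p Phi T f : (1 <= p)%R ->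
  young Phi -> delta2 Phi -> tiling (R := R) T -> measurable_fun setT f ->
  block_norm d p Phi T f <= 2%:E *
    associate_norm (morrey_tiling_norm d (hoelder_conjugate p%:E) (complementary Phi) T) f.
Proof.
move=> p1 yP dP tT mf; set N := associate_norm _ _.
have p0 : (0 < p)%R by exact: lt_le_trans p1.
have tT' := tiling_trivIset tT.
have sr0 (r : R) Q : (0 < side Q `^ r)%R by rewrite powR_gt0// side_gt0.
have test S (a : dyadic n -> R) (A : R) : S `<=` T ->
    (forall Q, S Q -> (0 < a Q)%R /\ (a Q)%:E < orlicz_avg Phi Q f) ->
    \esum_(Q in S) (side Q `^ d * a Q `^ p)%:E = A%:E -> (A `^ p^-1)%:E <= N.
  by move=> ST aS AE; exact: (@associate_tiling_ge p Phi T S f a A).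
have : 0 <= N.
  have := test set0 (fun=> 0%R) 0%R (@sub0set _ T) (fun _ => False_ind _).
  rewrite esum_set0 => /(_ erefl); apply: le_trans.
  by rewrite lee_fin powR_ge0.
case NE : N => [r||//] r0; last by rewrite gt0_muley ?lte_fin// leey.
rewrite lee_fin in r0.
have ff Q : T Q -> orlicz_avg Phi Q f < +oo.
  move=> TQ; rewrite ltey; apply/eqP => foo.
  pose c := (side Q `^ d `^ p^-1)%R.
  have c0 : (0 < c)%R by rewrite powR_gt0.
  pose b := ((r + 1) / c)%R.
  have b0 : (0 < b)%R by rewrite divr_gt0// ltr_wpDl.
  have QT : [set Q] `<=` T by move=> _ ->.
  have bQ P : [set Q] P -> (0 < b)%R /\ b%:E < orlicz_avg Phi P f.
    by move=> ->; rewrite foo ltry.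
  have bE : \esum_(P in [set Q]) (side P `^ d * b `^ p)%:E = (side Q `^ d * b `^ p)%:E.
    by rewrite esum_set1// lee_fin mulr_ge0 ?powR_ge0.
  have := test _ _ _ QT bQ bE; rewrite NE.
  rewrite lee_fin powRM ?powR_ge0// -[(b `^ p `^ _)%R]powRrM mulfV ?gt_eqF// powRr1 ?(ltW b0)//.
  rewrite -/c mulrC divfK ?gt_eqF// leNgt ltrDl ltr01//.
pose a Q := fine (orlicz_avg Phi Q f).
have aE Q : T Q -> orlicz_avg Phi Q f = (a Q)%:E.
  by move=> TQ; rewrite fineK// ge0_fin_numE ?ff// orlicz_avg_ge0.
have a0 Q : (0 <= a Q)%R by rewrite fine_ge0// orlicz_avg_ge0.
rewrite block_normE.
apply: (@le_trans _ _ ((((2 * r) `^ p)%:E) `^ p^-1)); last first.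
  by rewrite poweR_EFin -powRrM mulfV ?gt_eqF// powRr1 ?mulr_ge0// EFinM.
apply: le_poweR; [by rewrite invr_ge0 ltW|exact: choquet_ge0|].
apply: (@le_trans _ _ (\esum_(Q in T) ((side Q `^ d)%:E * (a Q `^ p)%:E))).
  apply: choquet_le_esum => [Q TQ|x]; first by rewrite lee_fin powR_ge0.
  have [Q TQ Qx] := tiling_cover x tT; exists Q => //; split => //.
  rewrite (esum_indic_disjoint (a := fun Q => orlicz_avg Phi Q f `^ p) tT' TQ Qx) ?aE//.
  by move=> *; exact: poweR_ge0.
apply: ge_ereal_sup => _ [S [finS ST] <-].
have t0 Q : 0 <= (side Q `^ d)%:E * (a Q `^ p)%:E.
  by rewrite -EFinM lee_fin mulr_ge0 ?powR_ge0.
rewrite -esum_fset//.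
pose S' := S `&` [set Q | (0 < a Q)%R].
have SE : \esum_(Q in S) ((side Q `^ d)%:E * (a Q `^ p)%:E) =
    (2 `^ p)%:E * \esum_(Q in S') (side Q `^ d * (a Q / 2) `^ p)%:E.
  rewrite -esumZl ?powR_ge0//; last by move=> Q _; rewrite lee_fin mulr_ge0 ?powR_ge0.
  rewrite esum_mkcondr; apply: eq_esum => Q SQ; case: ifPn => [_|/negP aQ].
    rewrite -!EFinM; congr EFin; rewrite mulrCA -powRM ?divr_ge0//.
    by rewrite [(2 * _)%R]mulrC divfK.
  rewrite (_ : a Q = 0%R) ?powR0 ?gt_eqF ?mule0//; apply/eqP.
  by rewrite eq_le a0 andbT leNgt; apply/negP => /mem_set.
have [A AE] : exists A, \esum_(Q in S') (side Q `^ d * (a Q / 2) `^ p)%:E = A%:E.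
  exists (\sum_(Q \in S') (side Q `^ d * (a Q / 2) `^ p))%R.
  have finS' : finite_set S' by exact: finite_setIl.
  rewrite esum_fset// ?fsumEFin// => Q _.
  by rewrite lee_fin mulr_ge0 ?powR_ge0.
have A0 : (0 <= A)%R.
  by rewrite -lee_fin -AE; apply: esum_ge0 => Q _; rewrite lee_fin mulr_ge0 ?powR_ge0.
have S'T : S' `<=` T by move=> Q [/ST].
have aS' Q : S' Q -> (0 < a Q / 2)%R /\ (a Q / 2)%:E < orlicz_avg Phi Q f.
  move=> [SQ /= aQ]; rewrite divr_gt0// aE ?lte_fin; last exact: ST.
  by rewrite gtr_pMr// invf_lt1// ltr1n.
have := test _ _ _ S'T aS' AE; rewrite NE.
rewrite lee_fin => Ar; rewrite SE AE -EFinM lee_fin powRM// ler_wpM2l ?powR_ge0//.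
have -> : A = ((A `^ p^-1) `^ p)%R by rewrite -powRrM mulVf ?gt_eqF// powRr1.
by apply: ge0_ler_powR; rewrite ?nnegrE ?powR_ge0 ?(ltW p0).
Qed.

End second_inequality.

Theorem theorem3p1 (R : realType) (n : nat) (d p : R) (Phi : R -> \bar R)
    (hn : (1 <= n)%N) (hd : (0 < d < n%:R)%R) (hp : (1 <= p)%R)
    (hPhi : young Phi) (hPhi2 : delta2 Phi) :
  exists C1 C2 : R, [/\ (0 < C1)%R, (0 < C2)%R &
    forall T : set (dyadic n), tiling (R := R) T ->
    forall f : Rn R n -> R, measurable_fun setT f ->
      associate_norm
        (morrey_norm d (hoelder_conjugate p%:E) (complementary Phi)) f
        <= C1%:E * block_norm d p Phi T f
      /\
      block_norm d p Phi T f
        <= C2%:E * associate_norm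
             (morrey_tiling_norm d (hoelder_conjugate p%:E)
                (complementary Phi) T) f].
Proof.
exists 12%R, 2%R; split => // T tT f mf; split.
- exact: associate_morrey_le_block.
- exact: block_le_associate_tiling.
Qed.
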